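(* Let $X:(M^2,g)\to(\mathbb{R}^3,h=dx^2+dy^2+dz^2)$, $X(s,v)=a(s)+vb$, be a cylinder with mean curvature function $H$, where $b$ is a constant unit vector in $\mathbb{R}^3$ and $a(s)$ is an immersed regular curve in $\mathbb{R}^3$ parametrized by arc length with geodesic curvature $\kappa_1(s)$ and satisfying $h(a',b)=0$. Then $X$ is proper $f$-biharmonic if and only if one of the following cases happens: (1) $\kappa_1$ is a nonzero constant, and the directrix $a(s)$ of the cylinder is (a part of) a circle with radius $\frac{1}{|\kappa_1|}$. Moreover, the mean curvature is $H=\frac{\kappa_1}{2}$ and $f=d_1e^{\kappa_1v}+d_2e^{-\kappa_1v}$, where $d_1,d_2$ are constants; or (2) $\kappa_1(s)$ is nonconstant, and the directrix $a(s)$ has geodesic curvature $\kappa_1(s)=\kappa_N(s,K)$ and geodesic torsion $\kappa_2=0$, where $K$ is a constant. Furthermore, the mean curvature is $H=\frac{\kappa_N(s,K)}{2}$ and $f=\psi(v,K)\kappa_N^{-3/2}(s,K)$.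
   Context: $g$ is the induced metric $ds^2+dv^2$. With unit normal $N=a'\times b$ to the surface, $\kappa_1$ and $\kappa_2$ are the curvature and torsion of $a$ with respect to the frame $\{a',N,-b\}$ along $a$ (so $a''=\kappa_1N$). For a map $\varphi:(M,g)\to\mathbb{R}^n$, $\tau(\varphi)=\mathrm{Trace}_g\nabla d\varphi$ and $\tau_2(\varphi)=\mathrm{Trace}_g(\nabla^\varphi\nabla^\varphi-\nabla^\varphi_{\nabla^M})\tau(\varphi)$. The map is biharmonic if $\tau_2(\varphi)=0$. For $f:M\to(0,+\infty)$ it is $f$-biharmonic if $f\tau_2(\varphi)+(\Delta f)\tau(\varphi)+2\nabla^\varphi_{\mathrm{grad}f}\tau(\varphi)=0$, and proper $f$-biharmonic if it is $f$-biharmonic but not biharmonic. A surface is (proper) $f$-biharmonic if its defining isometric immersion is. The functions are $$\psi(v,K)=\begin{cases} d_5\sin(\sqrt{-K}\,v)+d_6\cos(\sqrt{-K}\,v), & K<0,\\ d_3v+d_4, & K=0,\\ d_1e^{\sqrt K v}+d_2e^{-\sqrt Kv}, & K>0,\end{cases}$$ $$\kappa_N(s,K)=\begin{cases}\dfrac{1}{C_1e^{2\sqrt{-K}s}+C_2e^{-2\sqrt{-K}s}+\sqrt{4C_1C_2+\frac1K}}, & K<0,\\[3mm] \dfrac{4C_3}{16+C_3^2(s+C_4)^2}, & K=0,\\[3mm] \dfrac{1}{C_4\cos(2\sqrt Ks)+C_5\sin(2\sqrt Ks)+\sqrt{\frac1K+C_4^2+C_5^2}}, & K>0,\end{cases}$$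 where $d_i$ are constants (with $\psi>0$, since $f>0$) and $C_1>0$, $C_2>0$, $C_3>0$, $C_4$, $C_5$ are constants, with $4C_1C_2+\frac1K>0$ when $K<0$.
   Formalization: In case (2), κ₁=±κ_N and H=±κ_N/2 (κ₁ is signed, κ_N>0); for K<0 the square root may carry either sign and 4C₁C₂+1/K≥0 is allowed. As printed, ''only if'' fails for κ₁=1/cosh 2s, f=cos(v)cosh(2s)^{3/2}, |v|<π/2. *)

(* Defs.v *)
From Stdlib Require Import Reals.
From Coquelicot Require Export Coquelicot.
Open Scope R_scope.

(* ** Vectors of R^3 *)

(* The vector-space operations are Coquelicot's [plus], [minus], [scal], [zero]
   on products. *)
Definition R3 : Type := (R * R * R)%type.

Definition x1 (u : R3) : R := fst (fst u).
Definition x2 (u : R3) : R := snd (fst u).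
Definition x3 (u : R3) : R := snd u.

Definition dot (u w : R3) : R := x1 u * x1 w + x2 u * x2 w + x3 u * x3 w.

Definition cross (u w : R3) : R3 :=
  (x2 u * x3 w - x3 u * x2 w,
   x3 u * x1 w - x1 u * x3 w,
   x1 u * x2 w - x2 u * x1 w).

(* ** Parameter domains *)

Definition interval (lo hi : Rbar) (x : R) : Prop :=
  Rbar_lt lo x /\ Rbar_lt x hi.

Definition rectangle (I J : R -> Prop) (s v : R) : Prop := I s /\ J v.

Definition smooth (M : R -> R -> Prop) (u : R -> R -> R) : Prop :=
  forall n s v, M s v -> ex_diff_n u n s v.

(* ** Riemannian surfaces in one coordinate chart *)

Inductive coord : Set := cs | cv.

Definition sum2 (F : coord -> R) : R := F cs + F cv.

Definition pd (i : coord) (u : R -> R -> R) : R -> R -> R :=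
  fun s v =>
    match i with
    | cs => Derive (fun t => u t v) s
    | cv => Derive (fun t => u s t) v
    end.

(* [g s v i j] is the coefficient g_ij at the point (s, v). *)
Definition metric : Type := R -> R -> coord -> coord -> R.

Definition ginv (g : metric) (s v : R) (i j : coord) : R :=
  let G := g s v in
  let det := G cs cs * G cv cv - G cs cv * G cv cs in
  match i, j with
  | cs, cs => G cv cv / det
  | cs, cv => - G cs cv / det
  | cv, cs => - G cv cs / det
  | cv, cv => G cs cs / det
  end.

Definition christoffel (g : metric) (k i j : coord) (s v : R) : R :=
  / 2 * sum2 (fun l => ginv g s v k l *
          (pd i (fun s v => g s v j l) s v + pd j (fun s v => g s v i l) s v
           - pd l (fun s v => g s v i j) s v)).

(* (nabla d u)(d_i, d_j) *)
Definition hess (g : metric) (i j : coord) (u : R -> R -> R) : R -> R -> R :=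
  fun s v =>
    pd i (pd j u) s v - sum2 (fun k => christoffel g k i j s v * pd k u s v).

Definition laplace (g : metric) (u : R -> R -> R) : R -> R -> R :=
  fun s v => sum2 (fun i => sum2 (fun j => ginv g s v i j * hess g i j u s v)).

Definition grad (g : metric) (u : R -> R -> R) (s v : R) (i : coord) : R :=
  sum2 (fun j => ginv g s v i j * pd j u s v).

Definition dir_deriv (w : R -> R -> coord -> R) (u : R -> R -> R) : R -> R -> R :=
  fun s v => sum2 (fun i => w s v i * pd i u s v).

(* ** Maps into the flat R^3 *)

(* The Levi-Civita connection of R^3 is flat, so the pull-back connection along
   a map differentiates the Cartesian components. *)
Definition componentwise (L : (R -> R -> R) -> R -> R -> R)
    (V : R -> R -> R3) : R -> R -> R3 :=
  fun s v => (L (fun s v => x1 (V s v)) s v,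
              L (fun s v => x2 (V s v)) s v,
              L (fun s v => x3 (V s v)) s v).

(* Trace_g nabla d phi *)
Definition tension (g : metric) (phi : R -> R -> R3) : R -> R -> R3 :=
  componentwise (laplace g) phi.

(* Trace_g (nabla^phi nabla^phi - nabla^phi_{nabla^M}) of a section V of the
   pull-back bundle: in coordinates, g^ij (d_i d_j V - Gamma^k_ij d_k V). *)
Definition rough_laplace (g : metric) (V : R -> R -> R3) : R -> R -> R3 :=
  componentwise (laplace g) V.

Definition bitension (g : metric) (phi : R -> R -> R3) : R -> R -> R3 :=
  rough_laplace g (tension g phi).

Definition biharmonic (M : R -> R -> Prop) (g : metric) (phi : R -> R -> R3) : Prop :=
  forall s v, M s v -> bitension g phi s v = zero.

Definition f_biharmonic (M : R -> R -> Prop) (g : metric) (f : R -> R -> R)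
    (phi : R -> R -> R3) : Prop :=
  forall s v, M s v ->
    plus (plus (scal (f s v) (bitension g phi s v))
               (scal (laplace g f s v) (tension g phi s v)))
         (scal 2 (componentwise (dir_deriv (grad g f)) (tension g phi) s v))
    = zero.

Definition proper_f_biharmonic (M : R -> R -> Prop) (g : metric) (f : R -> R -> R)
    (phi : R -> R -> R3) : Prop :=
  f_biharmonic M g f phi /\ ~ biharmonic M g phi.

(* ** Surfaces in R^3 *)

Definition induced_metric (X : R -> R -> R3) : metric :=
  fun s v i j => dot (componentwise (pd i) X s v) (componentwise (pd j) X s v).

Definition proper_f_biharmonic_surface (M : R -> R -> Prop) (f : R -> R -> R)
    (X : R -> R -> R3) : Prop :=
  proper_f_biharmonic M (induced_metric X) f X.

(* Half the trace of the second fundamental form with respect to the unit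
   normal field [N]. *)
Definition mean_curvature (X N : R -> R -> R3) (s v : R) : R :=
  / 2 * sum2 (fun i => sum2 (fun j =>
    ginv (induced_metric X) s v i j *
    dot (componentwise (pd i) (componentwise (pd j) X) s v) (N s v))).

(* ** Curves and cylinders *)

Definition smooth_curve (I : R -> Prop) (a : R -> R3) : Prop :=
  forall n s, I s ->
    ex_derive_n (fun t => x1 (a t)) n s /\
    ex_derive_n (fun t => x2 (a t)) n s /\
    ex_derive_n (fun t => x3 (a t)) n s.

Definition deriv3 (a : R -> R3) (s : R) : R3 :=
  (Derive (fun t => x1 (a t)) s,
   Derive (fun t => x2 (a t)) s,
   Derive (fun t => x3 (a t)) s).

Definition cylinder (a : R -> R3) (b : R3) (s v : R) : R3 :=
  plus (a s) (scal v b).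

Definition normal (a : R -> R3) (b : R3) (s : R) : R3 := cross (deriv3 a s) b.

(* Curvature and torsion with respect to the frame {a', N, -b}:
   a'' = kappa1 N and N' = - kappa1 a' + kappa2 (-b). *)
Definition kappa1 (a : R -> R3) (b : R3) (s : R) : R :=
  dot (deriv3 (deriv3 a) s) (normal a b s).

Definition kappa2 (a : R -> R3) (b : R3) (s : R) : R :=
  dot (deriv3 (normal a b) s) (opp b).

Definition cylinder_H (a : R -> R3) (b : R3) : R -> R -> R :=
  mean_curvature (cylinder a b) (fun s _ => normal a b s).

Definition in_circle (I : R -> Prop) (a : R -> R3) (r : R) : Prop :=
  exists c n : R3, dot n n = 1 /\
    forall s, I s -> dot (minus (a s) c) n = 0 /\
                     sqrt (dot (minus (a s) c) (minus (a s) c)) = r.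

(* ** The explicit families *)

Definition psi (d1 d2 d3 d4 d5 d6 K v : R) : R :=
  if Rlt_dec K 0 then d5 * sin (sqrt (- K) * v) + d6 * cos (sqrt (- K) * v)
  else if Rlt_dec 0 K then d1 * exp (sqrt K * v) + d2 * exp (- sqrt K * v)
  else d3 * v + d4.

(* [sg = 1] or [-1] selects the square root for K < 0.  Both roots, and the zero
   root, give solutions: with K = -1, kappa = 1 / cosh (2 s) has zero root, and
   kappa = 1 / (2 cosh (2 s) - sqrt 3) the negative one.  For K > 0 the negative
   root makes the denominator negative, so it only yields opposites of members
   of the family. *)
Definition kappaN (sg C1 C2 C3 C4 C5 K s : R) : R :=
  if Rlt_dec K 0 then
    / (C1 * exp (2 * sqrt (- K) * s) + C2 * exp (- 2 * sqrt (- K) * s)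
       + sg * sqrt (4 * C1 * C2 + / K))
  else if Rlt_dec 0 K then
    / (C4 * cos (2 * sqrt K * s) + C5 * sin (2 * sqrt K * s)
       + sqrt (/ K + C4 ^ 2 + C5 ^ 2))
  else 4 * C3 / (16 + C3 ^ 2 * (s + C4) ^ 2).

Definition is_sign (e : R) : Prop := e = 1 \/ e = -1.

Definition kappaN_constants (sg C1 C2 C3 K : R) : Prop :=
  is_sign sg /\ 0 < C1 /\ 0 < C2 /\ 0 < C3 /\ (K < 0 -> 0 <= 4 * C1 * C2 + / K).

(* ** The two cases of the classification *)

Definition circular_case (I J : R -> Prop) (a : R -> R3) (b : R3)
    (f : R -> R -> R) : Prop :=
  exists k : R,
    k <> 0 /\
    (forall s, I s -> kappa1 a b s = k) /\
    in_circle I a (1 / Rabs k) /\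
    (forall s v, I s -> J v -> cylinder_H a b s v = k / 2) /\
    exists d1 d2 : R, forall s v, I s -> J v ->
      f s v = d1 * exp (k * v) + d2 * exp (- k * v).

(* [e] accounts for the orientation: replacing (b, v) by (-b, -v) leaves the
   surface unchanged and turns kappa1 into -kappa1, whereas kappaN > 0. *)
Definition nonconstant_case (I J : R -> Prop) (a : R -> R3) (b : R3)
    (f : R -> R -> R) : Prop :=
  (~ exists k : R, forall s, I s -> kappa1 a b s = k) /\
  exists K e sg C1 C2 C3 C4 C5 d1 d2 d3 d4 d5 d6 : R,
    is_sign e /\ kappaN_constants sg C1 C2 C3 K /\
    (forall s, I s -> kappa1 a b s = e * kappaN sg C1 C2 C3 C4 C5 K s) /\
    (forall s, I s -> kappa2 a b s = 0) /\
    (forall s v, I s -> J v ->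
       cylinder_H a b s v = e * kappaN sg C1 C2 C3 C4 C5 K s / 2) /\
    (forall s v, I s -> J v ->
       f s v = psi d1 d2 d3 d4 d5 d6 K v
               * Rpower (kappaN sg C1 C2 C3 C4 C5 K s) (- 3 / 2)).

(* Main.v *)
(* Along the frame {a', N, b} one has a'' = k N, a''' = k' N - k^2 a' and
   a'''' = (k'' - k^3) N - 3 k k' a', and the induced metric is flat, so
   f-biharmonicity is the pair of scalar equations
     f (k'' - k^3) + (Delta f) k + 2 f_s k' = 0,   3 f k k' + 2 f_s k^2 = 0.
   The second one says that f^2 k^3 depends on v only; hence k has a constant
   sign e unless it vanishes identically (the biharmonic case), and
   f = p(v) q(s)^(-3/2) with q = e k.  Inserting this into the first equation
   separates the variables: p'' = K p and 2 q q'' - 3 q'^2 + 4 q^4 = 4 K q^2.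
   The latter becomes, for w = 1 / q, a linear equation w'' = c - 4 K w. *)
Require Import Defs.
From Stdlib Require Import Reals Lra Classical.
From Coquelicot Require Import Coquelicot.
Open Scope R_scope.

(** All identities hold only on the open parameter intervals, bounded or not. Each differential
    equation is integrated there by exhibiting an expression with zero derivative, so no uniqueness
    theorem for solutions is invoked. The square roots in [kappaN] come from the first integral w'^2
    + 4 + 4 K w^2 = 2 c w. For K <> 0 put m = c / (4 K) and complete the square: w'^2 + 4 K (w -
    m)^2 = 4 K m^2 - 4. Since w - m solves the homogeneous equation, inserting its general form
    fixes m^2, as 4 C1 C2 + 1/K for K < 0 and as 1/K + C4^2 + C5^2 for K > 0, but leaves the sign of
    m open. For K > 0 the positivity of w forces m > 0. For K < 0 both signs survive, and the
    positivity of w is what makes C1 and C2 positive. For K = 0 the first integral itself gives w =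
    (w'^2 + 4) / (2 c) with w' affine. Constant curvature k goes through the same separation: there
    K = k^2, so only the exponential branch of [psi] occurs. *)

(** * Open intervals, locality of derivatives, and functions with zero derivative *)

Lemma locally_interval (lo hi : Rbar) (x : R) :
  interval lo hi x -> locally x (interval lo hi).
Proof.
  intros [h1 h2].
  apply filter_and.
  - exact (open_Rbar_gt lo x h1).
  - exact (open_Rbar_lt hi x h2).
Qed.

Lemma interval_convex (lo hi : Rbar) (x y t : R) :
  interval lo hi x -> interval lo hi y -> x <= t <= y -> interval lo hi t.
Proof.
  intros [h1 _] [_ h2] [h3 h4]; split.
  - apply Rbar_lt_le_trans with (1 := h1); exact h3.
  - apply Rbar_le_lt_trans with (2 := h2); exact h4.
Qed.

Lemma interval_nonempty (lo hi : Rbar) :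
  Rbar_lt lo hi -> exists x, interval lo hi x.
Proof.
  destruct lo as [l| |], hi as [h| |]; simpl; intros H; try easy.
  - exists ((l + h) / 2); split; simpl; lra.
  - exists (l + 1); split; simpl; trivial; lra.
  - exists (h - 1); split; simpl; trivial; lra.
  - exists 0; split; simpl; trivial.
Qed.

(** This is the only integration principle of the proof: conserved quantities of the differential
    equations are fed to it. *)
Lemma derive_zero_constant (lo hi : Rbar) (u : R -> R) :
  (forall x, interval lo hi x -> is_derive u x 0) ->
  forall x y, interval lo hi x -> interval lo hi y -> u x = u y.
Proof.
  intros hu x y hx hy.
  assert (hin : forall t, Rmin x y <= t <= Rmax x y -> interval lo hi t).
  { intros t ht; destruct (Rle_dec x y) as [h|h].
    - rewrite Rmin_left, Rmax_right in ht by lra.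
      apply interval_convex with x y; auto.
    - rewrite Rmin_right, Rmax_left in ht by lra.
      apply interval_convex with y x; auto. }
  destruct (MVT_gen u x y (fun _ => 0)) as [c [_ hc]].
  - intros t ht; apply hu, hin; lra.
  - intros t ht; apply derivable_continuous_pt.
    exists 0; apply is_derive_Reals, hu, hin, ht.
  - lra.
Qed.

Lemma is_derive_eq (u : R -> R) (x l l' : R) :
  is_derive u x l -> l = l' -> is_derive u x l'.
Proof. intros h <-; exact h. Qed.

(** [Derive] is total and the hypotheses say nothing outside the interval, so formulas can be
    differentiated only locally; openness of the interval makes this legitimate. *)
Lemma is_derive_eq_on (lo hi : Rbar) (u w : R -> R) (x l : R) :
  (forall t, interval lo hi t -> u t = w t) -> interval lo hi x ->
  is_derive w x l -> is_derive u x l.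
Proof.
  intros huw hx; apply is_derive_ext_loc.
  apply filter_imp with (2 := locally_interval lo hi x hx).
  intros t ht; symmetry; auto.
Qed.

Lemma Derive_eq_on (lo hi : Rbar) (u w : R -> R) (x : R) :
  (forall t, interval lo hi t -> u t = w t) -> interval lo hi x ->
  Derive u x = Derive w x.
Proof.
  intros huw hx; apply Derive_ext_loc.
  apply filter_imp with (2 := locally_interval lo hi x hx); auto.
Qed.

(** * Vectors and moving frames *)

Lemma R3_ext (u w : R3) : x1 u = x1 w -> x2 u = x2 w -> x3 u = x3 w -> u = w.
Proof.
  destruct u as [[u1 u2] u3], w as [[w1 w2] w3]; unfold x1, x2, x3; simpl.
  intros -> -> ->; reflexivity.
Qed.

Lemma x1_plus (u w : R3) : x1 (plus u w) = x1 u + x1 w. Proof. reflexivity. Qed.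
Lemma x2_plus (u w : R3) : x2 (plus u w) = x2 u + x2 w. Proof. reflexivity. Qed.
Lemma x3_plus (u w : R3) : x3 (plus u w) = x3 u + x3 w. Proof. reflexivity. Qed.
Lemma x1_opp (u : R3) : x1 (opp u) = - x1 u. Proof. reflexivity. Qed.
Lemma x2_opp (u : R3) : x2 (opp u) = - x2 u. Proof. reflexivity. Qed.
Lemma x3_opp (u : R3) : x3 (opp u) = - x3 u. Proof. reflexivity. Qed.
Lemma x1_scal (c : R) (u : R3) : x1 (scal c u) = c * x1 u. Proof. reflexivity. Qed.
Lemma x2_scal (c : R) (u : R3) : x2 (scal c u) = c * x2 u. Proof. reflexivity. Qed.
Lemma x3_scal (c : R) (u : R3) : x3 (scal c u) = c * x3 u. Proof. reflexivity. Qed.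
Lemma x1_cross (u w : R3) : x1 (cross u w) = x2 u * x3 w - x3 u * x2 w.
Proof. reflexivity. Qed.
Lemma x2_cross (u w : R3) : x2 (cross u w) = x3 u * x1 w - x1 u * x3 w.
Proof. reflexivity. Qed.
Lemma x3_cross (u w : R3) : x3 (cross u w) = x1 u * x2 w - x2 u * x1 w.
Proof. reflexivity. Qed.

Create HintDb coords.
#[local] Hint Rewrite x1_plus x2_plus x3_plus x1_opp x2_opp x3_opp x1_scal x2_scal
  x3_scal x1_cross x2_cross x3_cross : coords.

(** [zero] may occur at several convertible group structures on [R3]; matching on [?A] and using
    [change] treats them alike. *)
Ltac coords :=
  unfold minus, dot; autorewrite with coords;
  repeat match goal with
  | |- context [x1 (@zero ?A)] => change (x1 (@zero A)) with 0
  | |- context [x2 (@zero ?A)] => change (x2 (@zero A)) with 0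
  | |- context [x3 (@zero ?A)] => change (x3 (@zero A)) with 0
  end.

Lemma dot_cross_unit (t b : R3) :
  dot t t = 1 -> dot b b = 1 -> dot t b = 0 ->
  dot (cross t b) (cross t b) = 1.
Proof.
  intros ht hb htb.
  replace (dot (cross t b) (cross t b))
    with (dot t t * dot b b - dot t b * dot t b) by (coords; ring).
  rewrite ht, hb, htb; ring.
Qed.

Lemma orthogonal_frame (t b u : R3) :
  dot t t = 1 -> dot b b = 1 -> dot t b = 0 -> dot u t = 0 -> dot u b = 0 ->
  u = scal (dot u (cross t b)) (cross t b).
Proof.
  intros ht hb htb hut hub.
  pose proof (dot_cross_unit t b ht hb htb) as hn.
  (* Lagrange: u (n.n) - n (u.n) = n x (u x n), and u x (t x b) = t (u.b) - b (u.t). *)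
  assert (hL : scal (dot (cross t b) (cross t b)) u =
    plus (scal (dot u (cross t b)) (cross t b))
      (minus (scal (dot u b) (cross (cross t b) t))
             (scal (dot u t) (cross (cross t b) b)))).
  { apply R3_ext; coords; ring. }
  rewrite hn, hut, hub in hL.
  transitivity (scal 1 u); [apply R3_ext; coords; ring|].
  rewrite hL at 1; apply R3_ext; coords; ring.
Qed.

Lemma cross_cross_frame (t b : R3) :
  dot b b = 1 -> dot t b = 0 -> cross (cross t b) b = opp t.
Proof.
  intros hb htb.
  assert (h : cross (cross t b) b = minus (scal (dot t b) b) (scal (dot b b) t))
    by (apply R3_ext; coords; ring).
  rewrite h, hb, htb; apply R3_ext; coords; ring.
Qed.

Lemma dot_cross_l (t b : R3) : dot (cross t b) t = 0.
Proof. coords; ring. Qed.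

Lemma dot_cross_r (t b : R3) : dot (cross t b) b = 0.
Proof. coords; ring. Qed.

Lemma orthonormal_combination (n t : R3) (p q : R) :
  dot n n = 1 -> dot t t = 1 -> dot n t = 0 ->
  plus (scal p n) (scal q t) = zero <-> p = 0 /\ q = 0.
Proof.
  intros hn ht hnt; split.
  - intros h.
    assert (hp : dot (plus (scal p n) (scal q t)) n = p * dot n n + q * dot n t)
      by (coords; ring).
    assert (hq : dot (plus (scal p n) (scal q t)) t = p * dot n t + q * dot t t)
      by (coords; ring).
    rewrite h, hn, hnt in hp; rewrite h, ht, hnt in hq.
    assert (h0 : forall u, dot zero u = 0) by (intros u; coords; ring).
    rewrite h0 in hp, hq; lra.
  - intros [-> ->]; apply R3_ext; coords; ring.
Qed.

(** * Calculus along curves *)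

Definition is_derive3 (u : R -> R3) (s : R) (l : R3) : Prop :=
  is_derive (fun t => x1 (u t)) s (x1 l) /\
  is_derive (fun t => x2 (u t)) s (x2 l) /\
  is_derive (fun t => x3 (u t)) s (x3 l).

Lemma is_derive3_unique (u : R -> R3) (s : R) (l : R3) :
  is_derive3 u s l -> deriv3 u s = l.
Proof.
  intros (h1 & h2 & h3); apply R3_ext.
  - exact (is_derive_unique _ _ _ h1).
  - exact (is_derive_unique _ _ _ h2).
  - exact (is_derive_unique _ _ _ h3).
Qed.

Lemma is_derive3_eq_on (lo hi : Rbar) (u w : R -> R3) (s : R) (l : R3) :
  (forall t, interval lo hi t -> u t = w t) -> interval lo hi s ->
  is_derive3 w s l -> is_derive3 u s l.
Proof.
  intros huw hs (h1 & h2 & h3); split; [|split];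
    (eapply is_derive_eq_on; [|exact hs|eassumption]);
    intros t ht; simpl; rewrite (huw t ht); reflexivity.
Qed.

Lemma is_derive_Rmult (u w : R -> R) (s lu lw : R) :
  is_derive u s lu -> is_derive w s lw ->
  is_derive (fun t => u t * w t) s (lu * w s + u s * lw).
Proof.
  intros hu hw; apply (is_derive_mult u w s lu lw hu hw); intros; apply Rmult_comm.
Qed.

Lemma is_derive_dot (u w : R -> R3) (s : R) (lu lw : R3) :
  is_derive3 u s lu -> is_derive3 w s lw ->
  is_derive (fun t => dot (u t) (w t)) s (dot lu (w s) + dot (u s) lw).
Proof.
  intros (u1 & u2 & u3) (w1 & w2 & w3).
  pose proof (is_derive_plus _ _ _ _ _
    (is_derive_plus _ _ _ _ _ (is_derive_Rmult _ _ _ _ _ u1 w1)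
      (is_derive_Rmult _ _ _ _ _ u2 w2)) (is_derive_Rmult _ _ _ _ _ u3 w3)) as h.
  apply (is_derive_eq _ _ _ _ h); unfold plus; simpl; coords; ring.
Qed.

Lemma is_derive3_cross_const (u : R -> R3) (b : R3) (s : R) (l : R3) :
  is_derive3 u s l -> is_derive3 (fun t => cross (u t) b) s (cross l b).
Proof.
  assert (h : forall (f g : R -> R) (p q lf lg : R),
    is_derive f s lf -> is_derive g s lg ->
    is_derive (fun t => f t * p - g t * q) s (lf * p - lg * q)).
  { intros f g p q lf lg hf hg.
    pose proof (is_derive_minus _ _ _ _ _
      (is_derive_Rmult _ _ _ _ _ hf (is_derive_const p s))
      (is_derive_Rmult _ _ _ _ _ hg (is_derive_const q s))) as h.
    apply (is_derive_eq _ _ _ _ h).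
    unfold minus, plus, opp, zero; simpl; ring. }
  intros (u1 & u2 & u3); split; [|split]; apply h; assumption.
Qed.

Lemma is_derive3_scal (k : R -> R) (u : R -> R3) (s k' : R) (l : R3) :
  is_derive k s k' -> is_derive3 u s l ->
  is_derive3 (fun t => scal (k t) (u t)) s (plus (scal k' (u s)) (scal (k s) l)).
Proof.
  intros hk (u1 & u2 & u3).
  split; [|split]; apply (is_derive_Rmult k); assumption.
Qed.

Lemma is_derive3_plus (u w : R -> R3) (s : R) (lu lw : R3) :
  is_derive3 u s lu -> is_derive3 w s lw ->
  is_derive3 (fun t => plus (u t) (w t)) s (plus lu lw).
Proof.
  intros (u1 & u2 & u3) (w1 & w2 & w3); split; [|split];
    apply (is_derive_plus (V := R_NormedModule)); assumption.
Qed.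

Lemma ex_derive_n_Derive (u : R -> R) (n : nat) (s : R) :
  ex_derive_n u (S n) s -> ex_derive_n (Derive u) n s.
Proof.
  (* [ex_derive_n _ 0] is [True], while at [S n] it speaks about the [n]-th derivative; hence the
     case split. *)
  destruct n as [|n]; [easy|].
  apply ex_derive_ext; intros t.
  change (Derive u) with (Derive_n u 1); rewrite Derive_n_comp.
  rewrite Nat.add_1_r; reflexivity.
Qed.

Lemma smooth_curve_deriv3 (I : R -> Prop) (a : R -> R3) :
  smooth_curve I a -> smooth_curve I (deriv3 a).
Proof.
  intros ha n s hs; destruct (ha (S n) s hs) as (h1 & h2 & h3).
  split; [|split]; apply (ex_derive_n_Derive _ n s); assumption.
Qed.

Lemma smooth_curve_is_derive3 (I : R -> Prop) (a : R -> R3) (s : R) :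
  smooth_curve I a -> I s -> is_derive3 a s (deriv3 a s).
Proof.
  intros ha hs; destruct (ha 1%nat s hs) as (h1 & h2 & h3).
  split; [|split]; apply Derive_correct; assumption.
Qed.

(** * The frame of the cylinder *)

Definition unit_speed_orthogonal (lo hi : Rbar) (a : R -> R3) (b : R3) : Prop :=
  smooth_curve (interval lo hi) a /\
  (forall s, interval lo hi s -> dot (deriv3 a s) (deriv3 a s) = 1) /\
  dot b b = 1 /\
  (forall s, interval lo hi s -> dot (deriv3 a s) b = 0).

(** Differentiating a'.a' = 1 and a'.b = 0 shows that a'' is orthogonal to a' and b, so only its
    component along N remains. *)
Lemma acceleration_eq (lo hi : Rbar) (a : R -> R3) (b : R3) (s : R) :
  unit_speed_orthogonal lo hi a b -> interval lo hi s ->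
  deriv3 (deriv3 a) s = scal (kappa1 a b s) (normal a b s).
Proof.
  intros (ha & hu & hb & hab) hs.
  assert (h2 : is_derive3 (deriv3 a) s (deriv3 (deriv3 a) s)).
  { apply smooth_curve_is_derive3 with (interval lo hi); auto.
    apply smooth_curve_deriv3, ha. }
  apply orthogonal_frame; auto.
  - assert (h : 0 = dot (deriv3 (deriv3 a) s) (deriv3 a s)
                    + dot (deriv3 a s) (deriv3 (deriv3 a) s)).
    { rewrite <- (is_derive_unique _ _ _ (is_derive_dot _ _ _ _ _ h2 h2)).
      symmetry; rewrite (Derive_eq_on lo hi _ (fun _ => 1)); auto.
      apply Derive_const. }
    replace (dot (deriv3 a s) (deriv3 (deriv3 a) s))
      with (dot (deriv3 (deriv3 a) s) (deriv3 a s)) in h by (coords; ring).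
    lra.
  - assert (hc : is_derive3 (fun _ => b) s zero).
    { split; [|split]; [exact (is_derive_const (x1 b) s)
        |exact (is_derive_const (x2 b) s)|exact (is_derive_const (x3 b) s)]. }
    pose proof (is_derive_unique _ _ _ (is_derive_dot _ _ _ _ _ h2 hc)) as h.
    rewrite (Derive_eq_on lo hi _ (fun _ => 0)) in h; auto.
    rewrite Derive_const in h.
    replace (dot (deriv3 a s) zero) with 0 in h by (coords; ring).
    lra.
Qed.

Lemma normal_derive (lo hi : Rbar) (a : R -> R3) (b : R3) (s : R) :
  unit_speed_orthogonal lo hi a b -> interval lo hi s ->
  is_derive3 (normal a b) s (scal (- kappa1 a b s) (deriv3 a s)).
Proof.
  intros ha hs; pose proof (acceleration_eq lo hi a b s ha hs) as h2.
  destruct ha as (ha & hu & hb & hab).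
  replace (scal (- kappa1 a b s) (deriv3 a s)) with (cross (deriv3 (deriv3 a) s) b).
  - apply is_derive3_cross_const, smooth_curve_is_derive3 with (interval lo hi); auto.
    apply smooth_curve_deriv3, ha.
  - rewrite h2.
    transitivity (scal (kappa1 a b s) (cross (normal a b s) b)).
    + apply R3_ext; coords; ring.
    + unfold normal at 1; rewrite cross_cross_frame; auto.
      apply R3_ext; coords; ring.
Qed.

(** The term a''.N' drops out because a'' is parallel to N and N' to a'. What remains is a dot
    product of differentiable curves, so it can be differentiated once more. *)
Lemma kappa1_is_derive (lo hi : Rbar) (a : R -> R3) (b : R3) (s : R) :
  unit_speed_orthogonal lo hi a b -> interval lo hi s ->
  is_derive (kappa1 a b) s (dot (deriv3 (deriv3 (deriv3 a)) s) (normal a b s)).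
Proof.
  intros ha hs; pose proof (normal_derive lo hi a b s ha hs) as hn.
  pose proof (acceleration_eq lo hi a b s ha hs) as h2.
  assert (h3 : is_derive3 (deriv3 (deriv3 a)) s (deriv3 (deriv3 (deriv3 a)) s)).
  { apply smooth_curve_is_derive3 with (interval lo hi); auto.
    apply smooth_curve_deriv3, smooth_curve_deriv3, ha. }
  apply (is_derive_eq _ _ _ _ (is_derive_dot _ _ _ _ _ h3 hn)).
  rewrite h2; unfold normal.
  match goal with |- _ + ?z = _ => replace z with 0 end; [ring|].
  coords; ring.
Qed.

Lemma ex_derive_Derive_kappa1 (lo hi : Rbar) (a : R -> R3) (b : R3) (s : R) :
  unit_speed_orthogonal lo hi a b -> interval lo hi s ->
  ex_derive (Derive (kappa1 a b)) s.
Proof.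
  intros ha hs; pose proof (normal_derive lo hi a b s ha hs) as hn.
  assert (h4 : is_derive3 (deriv3 (deriv3 (deriv3 a))) s
                 (deriv3 (deriv3 (deriv3 (deriv3 a))) s)).
  { apply smooth_curve_is_derive3 with (interval lo hi); auto.
    do 3 apply smooth_curve_deriv3; apply ha. }
  eexists; eapply is_derive_eq_on with (2 := hs);
    [|exact (is_derive_dot _ _ _ _ _ h4 hn)].
  intros t ht; apply is_derive_unique, kappa1_is_derive with lo hi; auto.
Qed.

Lemma kappa1_derives (lo hi : Rbar) (a : R -> R3) (b : R3) (s : R) :
  unit_speed_orthogonal lo hi a b -> interval lo hi s ->
  is_derive (kappa1 a b) s (Derive (kappa1 a b) s) /\
  is_derive (Derive (kappa1 a b)) s (Derive (Derive (kappa1 a b)) s).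
Proof.
  intros ha hs; split; apply Derive_correct.
  - eexists; apply kappa1_is_derive with lo hi; auto.
  - apply ex_derive_Derive_kappa1 with lo hi; auto.
Qed.

Lemma third_derivative_eq (lo hi : Rbar) (a : R -> R3) (b : R3) (s : R) :
  unit_speed_orthogonal lo hi a b -> interval lo hi s ->
  deriv3 (deriv3 (deriv3 a)) s =
    plus (scal (Derive (kappa1 a b) s) (normal a b s))
         (scal (- kappa1 a b s ^ 2) (deriv3 a s)).
Proof.
  intros ha hs; destruct (kappa1_derives lo hi a b s ha hs) as [hk _].
  apply is_derive3_unique.
  apply is_derive3_eq_on with (2 := hs)
    (w := fun t => scal (kappa1 a b t) (normal a b t)).
  - intros t ht; apply acceleration_eq with lo hi; auto.
  - pose proof (is_derive3_scal _ _ _ _ _ hk (normal_derive lo hi a b s ha hs)) as h.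
    (* [eq_rect] replaces the derivative in [h] by the desired one and leaves their equality as a
       goal. *)
    apply (eq_rect _ (is_derive3 _ s) h); apply R3_ext; coords; ring.
Qed.

Lemma fourth_derivative_eq (lo hi : Rbar) (a : R -> R3) (b : R3) (s : R) :
  unit_speed_orthogonal lo hi a b -> interval lo hi s ->
  deriv3 (deriv3 (deriv3 (deriv3 a))) s =
    plus (scal (Derive (Derive (kappa1 a b)) s - kappa1 a b s ^ 3) (normal a b s))
         (scal (- 3 * kappa1 a b s * Derive (kappa1 a b) s) (deriv3 a s)).
Proof.
  intros ha hs; destruct (kappa1_derives lo hi a b s ha hs) as [hk hk'].
  apply is_derive3_unique.
  apply is_derive3_eq_on with (2 := hs)
    (w := fun t => plus (scal (Derive (kappa1 a b) t) (normal a b t))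
                        (scal (- kappa1 a b t ^ 2) (deriv3 a t))).
  - intros t ht; apply third_derivative_eq with lo hi; auto.
  - assert (hk2 : is_derive (fun t => - kappa1 a b t ^ 2) s
                    (- (2 * kappa1 a b s * Derive (kappa1 a b) s))).
    { apply (is_derive_ext (fun t => - (kappa1 a b t * kappa1 a b t))).
      { intros t; simpl; ring. }
      apply (is_derive_eq _ _ _ _
        (is_derive_opp _ _ _ (is_derive_Rmult _ _ _ _ _ hk hk))).
      unfold opp; simpl; ring. }
    assert (h1 : is_derive3 (deriv3 a) s (scal (kappa1 a b s) (normal a b s))).
    { rewrite <- (acceleration_eq lo hi) by auto.
      apply smooth_curve_is_derive3 with (interval lo hi); auto.
      apply smooth_curve_deriv3, ha. }
    pose proof (is_derive3_plus _ _ _ _ _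
      (is_derive3_scal _ _ _ _ _ hk' (normal_derive lo hi a b s ha hs))
      (is_derive3_scal _ _ _ _ _ hk2 h1)) as h.
    apply (eq_rect _ (is_derive3 _ s) h); apply R3_ext; coords; ring.
Qed.

(** N' = - k a' has no component along b, since the directrix lies in a plane orthogonal to b. *)
Lemma kappa2_cylinder (lo hi : Rbar) (a : R -> R3) (b : R3) (s : R) :
  unit_speed_orthogonal lo hi a b -> interval lo hi s -> kappa2 a b s = 0.
Proof.
  intros ha hs; unfold kappa2.
  rewrite (is_derive3_unique _ _ _ (normal_derive lo hi a b s ha hs)).
  assert (h : dot (deriv3 a s) b = 0) by (apply ha; auto).
  transitivity (kappa1 a b s * dot (deriv3 a s) b); [coords; ring|].
  rewrite h; ring.
Qed.

(** The centre of curvature a + N / k is stationary, its derivative being a' - a'. The radius vector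
    - N / k is orthogonal to b and has length 1 / |k|. *)
Lemma in_circle_of_constant_kappa1 (lo hi : Rbar) (a : R -> R3) (b : R3) (k : R) :
  unit_speed_orthogonal lo hi a b -> Rbar_lt lo hi -> k <> 0 ->
  (forall s, interval lo hi s -> kappa1 a b s = k) ->
  in_circle (interval lo hi) a (1 / Rabs k).
Proof.
  intros ha hlt hk hkap.
  destruct (interval_nonempty lo hi hlt) as [t ht].
  set (center := fun s => plus (a s) (scal (/ k) (normal a b s))).
  assert (hc : forall s, interval lo hi s -> is_derive3 center s zero).
  { intros s hs.
    assert (h1 : is_derive3 a s (deriv3 a s))
      by (apply smooth_curve_is_derive3 with (interval lo hi); auto; apply ha).
    pose proof (is_derive3_plus _ _ _ _ _ h1
      (is_derive3_scal _ _ _ _ _ (is_derive_const (/ k) s)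
        (normal_derive lo hi a b s ha hs))) as h.
    apply (eq_rect _ (is_derive3 _ s) h); rewrite hkap by auto.
    unfold zero at 1; simpl; apply R3_ext; coords; field; auto. }
  assert (hcc : forall s, interval lo hi s -> center s = center t).
  { intros s hs; apply R3_ext;
      [apply (derive_zero_constant lo hi (fun r => x1 (center r)))
      |apply (derive_zero_constant lo hi (fun r => x2 (center r)))
      |apply (derive_zero_constant lo hi (fun r => x3 (center r)))];
      auto; intros r hr; apply (hc r hr). }
  exists (center t), b; split; [apply ha|].
  intros s hs; rewrite <- (hcc s hs).
  destruct ha as (_ & hu & hb & hab).
  assert (hd : minus (a s) (center s) = scal (- / k) (normal a b s))
    by (unfold center; apply R3_ext; coords; ring).
  rewrite hd; split.
  - transitivity (- / k * dot (normal a b s) b); [coords; ring|].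
    unfold normal; rewrite dot_cross_r; ring.
  - replace (dot (scal (- / k) (normal a b s)) (scal (- / k) (normal a b s)))
      with (Rsqr (/ k) * dot (normal a b s) (normal a b s))
      by (unfold Rsqr; coords; ring).
    unfold normal; rewrite dot_cross_unit by auto.
    rewrite Rmult_1_r, sqrt_Rsqr_abs, Rabs_inv; unfold Rdiv; ring.
Qed.

(** * The flat metric of the cylinder *)

Lemma pd_cs_cylinder (lo hi : Rbar) (a : R -> R3) (b : R3) (s v : R) :
  smooth_curve (interval lo hi) a -> interval lo hi s ->
  componentwise (pd cs) (cylinder a b) s v = deriv3 a s.
Proof.
  intros ha hs; destruct (smooth_curve_is_derive3 _ a s ha hs) as (h1 & h2 & h3).
  assert (h : forall (u : R -> R) c, ex_derive u s ->
    Derive (fun t => u t + c) s = Derive u s).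
  { intros u c hu; rewrite Derive_plus, Derive_const
      by (auto; apply ex_derive_const); ring. }
  apply R3_ext; apply h; eexists; eassumption.
Qed.

Lemma pd_cv_cylinder (a : R -> R3) (b : R3) (s v : R) :
  componentwise (pd cv) (cylinder a b) s v = b.
Proof.
  assert (h : forall c d : R, Derive (fun t => c + t * d) v = d).
  { intros c d; apply is_derive_unique; auto_derive; [trivial|ring]. }
  apply R3_ext; apply h.
Qed.

Lemma induced_metric_cylinder (lo hi : Rbar) (a : R -> R3) (b : R3) (s v : R)
    (i j : coord) :
  unit_speed_orthogonal lo hi a b -> interval lo hi s ->
  induced_metric (cylinder a b) s v i j =
    match i, j with cs, cs | cv, cv => 1 | _, _ => 0 end.
Proof.
  intros (ha & hu & hb & hab) hs.
  unfold induced_metric.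
  destruct i, j;
    rewrite ?(pd_cs_cylinder lo hi), ?pd_cv_cylinder by auto; auto.
  rewrite <- (hab s hs); coords; ring.
Qed.

(** The metric coefficients are constant near the point, so all Christoffel symbols vanish there. *)
Lemma laplace_cylinder (s0 s1 v0 v1 : Rbar) (a : R -> R3) (b : R3)
    (u : R -> R -> R) (s v : R) :
  unit_speed_orthogonal s0 s1 a b -> interval s0 s1 s -> interval v0 v1 v ->
  laplace (induced_metric (cylinder a b)) u s v =
    pd cs (pd cs u) s v + pd cv (pd cv u) s v.
Proof.
  intros ha hs hv.
  assert (hg : forall l i j,
    pd l (fun s v => induced_metric (cylinder a b) s v i j) s v = 0).
  { intros [] i j; unfold pd.
    - rewrite (Derive_eq_on s0 s1 _
        (fun _ => match i, j with cs, cs | cv, cv => 1 | _, _ => 0 end)); auto.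
      + apply Derive_const.
      + intros t ht; apply induced_metric_cylinder with s0 s1; auto.
    - rewrite (Derive_ext _
        (fun _ => match i, j with cs, cs | cv, cv => 1 | _, _ => 0 end)).
      + apply Derive_const.
      + intros t; apply induced_metric_cylinder with s0 s1; auto. }
  assert (hch : forall k i j, christoffel (induced_metric (cylinder a b)) k i j s v = 0).
  { intros k i j; unfold christoffel, sum2; rewrite !hg; ring. }
  unfold laplace, sum2, hess, sum2, ginv.
  rewrite !hch, !(induced_metric_cylinder s0 s1) by auto.
  field.
Qed.

(** One form serves both the coordinates of the cylinder, with [c] a coordinate of [b], and those of
    its tension field, with [c = 0]. *)
Lemma laplace_cylinder_affine (s0 s1 v0 v1 : Rbar) (a : R -> R3) (b : R3)
    (u : R -> R -> R) (w : R -> R) (c s v : R) :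
  unit_speed_orthogonal s0 s1 a b -> interval s0 s1 s -> interval v0 v1 v ->
  (forall t, interval s0 s1 t -> ex_derive w t) ->
  (forall t r, interval s0 s1 t -> interval v0 v1 r -> u t r = w t + r * c) ->
  laplace (induced_metric (cylinder a b)) u s v = Derive (Derive w) s.
Proof.
  intros ha hs hv hw hu.
  rewrite (laplace_cylinder s0 s1 v0 v1) by auto.
  assert (h1 : pd cs (pd cs u) s v = Derive (Derive w) s).
  { apply Derive_eq_on with s0 s1; auto.
    intros t ht; simpl.
    rewrite (Derive_eq_on s0 s1 _ (fun t => w t + v * c)); auto.
    rewrite Derive_plus, Derive_const; auto using ex_derive_const; ring. }
  assert (h2 : pd cv (pd cv u) s v = 0).
  { simpl; rewrite (Derive_eq_on v0 v1 _ (fun _ => c)); auto.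
    - apply Derive_const.
    - intros r hr.
      rewrite (Derive_eq_on v0 v1 _ (fun r => w s + r * c)); auto.
      apply is_derive_unique; auto_derive; [trivial|ring]. }
  rewrite h1, h2; ring.
Qed.

Lemma tension_cylinder (s0 s1 v0 v1 : Rbar) (a : R -> R3) (b : R3) (s v : R) :
  unit_speed_orthogonal s0 s1 a b -> interval s0 s1 s -> interval v0 v1 v ->
  tension (induced_metric (cylinder a b)) (cylinder a b) s v = deriv3 (deriv3 a) s.
Proof.
  intros ha hs hv.
  assert (h : forall t, interval s0 s1 t -> is_derive3 a t (deriv3 a t))
    by (intros; apply smooth_curve_is_derive3 with (interval s0 s1); auto; apply ha).
  apply R3_ext;
    [apply (laplace_cylinder_affine s0 s1 v0 v1) with (c := x1 b) (w := fun t => x1 (a t))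
    |apply (laplace_cylinder_affine s0 s1 v0 v1) with (c := x2 b) (w := fun t => x2 (a t))
    |apply (laplace_cylinder_affine s0 s1 v0 v1) with (c := x3 b) (w := fun t => x3 (a t))];
    auto; intros t ht; eexists; apply (h t ht).
Qed.

Lemma bitension_cylinder (s0 s1 v0 v1 : Rbar) (a : R -> R3) (b : R3) (s v : R) :
  unit_speed_orthogonal s0 s1 a b -> interval s0 s1 s -> interval v0 v1 v ->
  bitension (induced_metric (cylinder a b)) (cylinder a b) s v =
    deriv3 (deriv3 (deriv3 (deriv3 a))) s.
Proof.
  intros ha hs hv.
  assert (h : forall t, interval s0 s1 t ->
    is_derive3 (deriv3 (deriv3 a)) t (deriv3 (deriv3 (deriv3 a)) t)).
  { intros; apply smooth_curve_is_derive3 with (interval s0 s1); auto.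
    apply smooth_curve_deriv3, smooth_curve_deriv3, ha. }
  assert (hL : forall x : R3 -> R,
    (forall t, interval s0 s1 t ->
      is_derive (fun t => x (deriv3 (deriv3 a) t)) t (x (deriv3 (deriv3 (deriv3 a)) t))) ->
    laplace (induced_metric (cylinder a b))
      (fun s v => x (tension (induced_metric (cylinder a b)) (cylinder a b) s v)) s v
    = Derive (Derive (fun t => x (deriv3 (deriv3 a) t))) s).
  { intros x hx; apply (laplace_cylinder_affine s0 s1 v0 v1) with (c := 0); auto.
    - intros t ht; eexists; apply hx; auto.
    - intros t r ht hr; rewrite (tension_cylinder s0 s1 v0 v1) by auto; ring. }
  apply R3_ext; [apply (hL x1)|apply (hL x2)|apply (hL x3)];
    intros t ht; apply (h t ht).
Qed.

(** The tension field a'' does not depend on v, so only the s-component of grad f contributes. *)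
Lemma grad_tension_cylinder (s0 s1 v0 v1 : Rbar) (a : R -> R3) (b : R3)
    (f : R -> R -> R) (s v : R) :
  unit_speed_orthogonal s0 s1 a b -> interval s0 s1 s -> interval v0 v1 v ->
  componentwise (dir_deriv (grad (induced_metric (cylinder a b)) f))
    (tension (induced_metric (cylinder a b)) (cylinder a b)) s v =
  scal (pd cs f s v) (deriv3 (deriv3 (deriv3 a)) s).
Proof.
  intros ha hs hv.
  assert (h : forall (u : R -> R -> R) (w : R -> R),
    (forall t r, interval s0 s1 t -> interval v0 v1 r -> u t r = w t) ->
    dir_deriv (grad (induced_metric (cylinder a b)) f) u s v
      = pd cs f s v * Derive w s).
  { intros u w hu; unfold dir_deriv, sum2.
    assert (h1 : pd cs u s v = Derive w s)
      by (apply Derive_eq_on with s0 s1; auto).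
    assert (h2 : pd cv u s v = 0).
    { simpl; rewrite (Derive_eq_on v0 v1 _ (fun _ => w s)); auto.
      apply Derive_const. }
    rewrite h1, h2; unfold grad, sum2, ginv.
    rewrite !(induced_metric_cylinder s0 s1) by auto; field. }
  apply R3_ext; apply h; intros t r ht hr;
    rewrite (tension_cylinder s0 s1 v0 v1) by auto; reflexivity.
Qed.

Lemma cylinder_H_eq (s0 s1 : Rbar) (a : R -> R3) (b : R3) (s v : R) :
  unit_speed_orthogonal s0 s1 a b -> interval s0 s1 s ->
  cylinder_H a b s v = kappa1 a b s / 2.
Proof.
  intros ha hs; unfold cylinder_H, mean_curvature, sum2, ginv.
  rewrite !(induced_metric_cylinder s0 s1) by auto.
  assert (hss : componentwise (pd cs) (componentwise (pd cs) (cylinder a b)) s v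
    = deriv3 (deriv3 a) s).
  { apply R3_ext; apply Derive_eq_on with s0 s1; auto;
      intros t ht; rewrite (pd_cs_cylinder s0 s1) by (auto; apply ha); reflexivity. }
  assert (hvv : componentwise (pd cv) (componentwise (pd cv) (cylinder a b)) s v = zero).
  { apply R3_ext; [transitivity (Derive (fun _ => x1 b) v)
      |transitivity (Derive (fun _ => x2 b) v)|transitivity (Derive (fun _ => x3 b) v)];
      try (rewrite Derive_const; reflexivity);
      apply Derive_ext; intros r; rewrite pd_cv_cylinder; reflexivity. }
  rewrite hss, hvv; unfold kappa1, Rdiv.
  replace (dot zero (normal a b s)) with 0 by (coords; ring).
  field.
Qed.

Lemma f_biharmonic_cylinder_iff (s0 s1 v0 v1 : Rbar) (a : R -> R3) (b : R3)
    (f : R -> R -> R) :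
  unit_speed_orthogonal s0 s1 a b ->
  f_biharmonic (rectangle (interval s0 s1) (interval v0 v1))
    (induced_metric (cylinder a b)) f (cylinder a b) <->
  forall s v, interval s0 s1 s -> interval v0 v1 v ->
    f s v * (Derive (Derive (kappa1 a b)) s - kappa1 a b s ^ 3)
      + (pd cs (pd cs f) s v + pd cv (pd cv f) s v) * kappa1 a b s
      + 2 * pd cs f s v * Derive (kappa1 a b) s = 0 /\
    3 * f s v * kappa1 a b s * Derive (kappa1 a b) s
      + 2 * pd cs f s v * kappa1 a b s ^ 2 = 0.
Proof.
  intros ha.
  assert (h : forall s v, interval s0 s1 s -> interval v0 v1 v ->
    plus (plus (scal (f s v)
                 (bitension (induced_metric (cylinder a b)) (cylinder a b) s v))
               (scal (laplace (induced_metric (cylinder a b)) f s v)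
                 (tension (induced_metric (cylinder a b)) (cylinder a b) s v)))
         (scal 2 (componentwise (dir_deriv (grad (induced_metric (cylinder a b)) f))
                   (tension (induced_metric (cylinder a b)) (cylinder a b)) s v)) =
    plus (scal (f s v * (Derive (Derive (kappa1 a b)) s - kappa1 a b s ^ 3)
      + (pd cs (pd cs f) s v + pd cv (pd cv f) s v) * kappa1 a b s
      + 2 * pd cs f s v * Derive (kappa1 a b) s) (normal a b s))
      (scal (- (3 * f s v * kappa1 a b s * Derive (kappa1 a b) s
      + 2 * pd cs f s v * kappa1 a b s ^ 2)) (deriv3 a s))).
  { intros s v hs hv.
    rewrite (bitension_cylinder s0 s1 v0 v1), (tension_cylinder s0 s1 v0 v1),
      (grad_tension_cylinder s0 s1 v0 v1), (laplace_cylinder s0 s1 v0 v1),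
      (acceleration_eq s0 s1 a b), (third_derivative_eq s0 s1 a b),
      (fourth_derivative_eq s0 s1 a b) by auto.
    apply R3_ext; coords; ring. }
  assert (hiff : forall s p q, interval s0 s1 s ->
    plus (scal p (normal a b s)) (scal q (deriv3 a s)) = zero <-> p = 0 /\ q = 0).
  { intros s p q hs; destruct ha as (_ & hu & hb & hab).
    apply orthonormal_combination; auto.
    - apply dot_cross_unit; auto.
    - apply dot_cross_l. }
  split.
  - intros hf s v hs hv; specialize (hf s v (conj hs hv)).
    rewrite h in hf by auto; apply hiff in hf; auto; lra.
  - intros hf s v [hs hv]; rewrite h by auto; apply hiff; auto.
    destruct (hf s v hs hv); lra.
Qed.

(** The tangential part k k' = 0 makes k^2 constant. If k were nonzero somewhere, it would be
    nonzero everywhere, so k' = k'' = 0, and the normal part k'' - k^3 = 0 would give k = 0. *)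
Lemma biharmonic_cylinder_iff (s0 s1 v0 v1 : Rbar) (a : R -> R3) (b : R3) :
  unit_speed_orthogonal s0 s1 a b -> Rbar_lt v0 v1 ->
  biharmonic (rectangle (interval s0 s1) (interval v0 v1))
    (induced_metric (cylinder a b)) (cylinder a b) <->
  forall s, interval s0 s1 s -> kappa1 a b s = 0.
Proof.
  intros ha hv; destruct (interval_nonempty _ _ hv) as [v hv'].
  split.
  - intros hbi.
    assert (hk : forall s, interval s0 s1 s ->
      Derive (Derive (kappa1 a b)) s - kappa1 a b s ^ 3 = 0 /\
      - 3 * kappa1 a b s * Derive (kappa1 a b) s = 0).
    { intros s hs; pose proof (hbi s v (conj hs hv')) as h.
      rewrite (bitension_cylinder s0 s1 v0 v1), (fourth_derivative_eq s0 s1 a b) in h by auto.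
      destruct ha as (_ & hu & hb & hab).
      apply orthonormal_combination in h; auto.
      - apply dot_cross_unit; auto.
      - apply dot_cross_l. }
    assert (hconst : forall s t, interval s0 s1 s -> interval s0 s1 t ->
      kappa1 a b s * kappa1 a b s = kappa1 a b t * kappa1 a b t).
    { apply (derive_zero_constant s0 s1 (fun t => kappa1 a b t * kappa1 a b t)).
      intros s hs; destruct (kappa1_derives s0 s1 a b s ha hs) as [h _].
      apply (is_derive_eq _ _ _ _ (is_derive_Rmult _ _ _ _ _ h h)).
      destruct (hk s hs); lra. }
    intros s hs.
    destruct (Req_dec (kappa1 a b s) 0) as [h0|h0]; auto.
    assert (hd : forall t, interval s0 s1 t -> Derive (kappa1 a b) t = 0).
    { intros t ht; destruct (hk t ht) as [_ h].
      assert (kappa1 a b t <> 0).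
      { intros h1; apply h0; pose proof (hconst s t hs ht) as hc.
        rewrite h1 in hc; nra. }
      destruct (Rmult_integral _ _ h); auto; lra. }
    destruct (hk s hs) as [h _].
    rewrite (Derive_eq_on s0 s1 _ (fun _ => 0)), Derive_const in h; auto.
    assert (h3 : kappa1 a b s ^ 3 <> 0) by (apply pow_nonzero; auto).
    lra.
  - intros hk s v' [hs hv''].
    rewrite (bitension_cylinder s0 s1 v0 v1), (fourth_derivative_eq s0 s1 a b) by auto.
    rewrite (Derive_eq_on s0 s1 (Derive (kappa1 a b)) (fun _ => 0)); auto.
    + rewrite Derive_const, hk by auto; apply R3_ext; coords; ring.
    + intros t ht; rewrite (Derive_eq_on s0 s1 _ (fun _ => 0)); auto.
      apply Derive_const.
Qed.

(** * Linear equations with constant coefficients *)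

(** [auto_derive] leaves derivatives of abstract functions as [Derive] terms; this substitutes the
    values recorded in the context. *)
Ltac derive_from_hyps :=
  repeat match goal with
  | H : is_derive ?u ?x ?l |- _ =>
      progress (replace (Derive (fun t : R => u t) x) with l
        by (symmetry; exact (is_derive_unique _ _ _ H)))
  end.

Lemma ode_zero (lo hi : Rbar) (y y' : R -> R) (x0 : R) :
  interval lo hi x0 ->
  (forall x, interval lo hi x -> is_derive y x (y' x) /\ is_derive y' x 0) ->
  forall x, interval lo hi x -> y x = y' x0 * x + (y x0 - y' x0 * x0).
Proof.
  intros hx0 hy x hx.
  assert (h1 : forall t, interval lo hi t -> y' t = y' x0)
    by (intros t ht; apply (derive_zero_constant lo hi y'); auto; intros; apply hy; auto).
  assert (h2 : y x - y' x0 * x = y x0 - y' x0 * x0); [|lra].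
  apply (derive_zero_constant lo hi (fun t => y t - y' x0 * t)); auto.
  intros t ht; destruct (hy t ht) as [h _]; auto_derive.
  - repeat split; eexists; eassumption.
  - derive_from_hyps; rewrite h1 by auto; ring.
Qed.

(** For c = w and c = - w one has (y' + c y)' = c (y' + c y), so (y' + c y) exp(- c x) is constant.
    The two constants, divided by 2 w and the second negated, are the coefficients. *)
Lemma ode_exp (lo hi : Rbar) (y y' : R -> R) (w : R) :
  Rbar_lt lo hi -> 0 < w ->
  (forall x, interval lo hi x -> is_derive y x (y' x) /\ is_derive y' x (w ^ 2 * y x)) ->
  exists p q, forall x, interval lo hi x ->
    y x = p * exp (w * x) + q * exp (- w * x) /\
    y' x = w * (p * exp (w * x) - q * exp (- w * x)).
Proof.
  intros hlt hw hy; destruct (interval_nonempty _ _ hlt) as [x0 hx0].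
  assert (hu : forall c, c = w \/ c = - w -> forall x, interval lo hi x ->
    (y' x + c * y x) * exp (- c * x) = (y' x0 + c * y x0) * exp (- c * x0)).
  { intros c hc x hx.
    apply (derive_zero_constant lo hi (fun x => (y' x + c * y x) * exp (- c * x))); auto.
    intros t ht; destruct (hy t ht) as [h h']; auto_derive.
    - repeat split; eexists; eassumption.
    - derive_from_hyps; destruct hc as [-> | ->]; ring. }
  exists ((y' x0 + w * y x0) * exp (- w * x0) / (2 * w)),
    (- ((y' x0 + - w * y x0) * exp (- - w * x0)) / (2 * w)).
  intros x hx; rewrite <- (hu w (or_introl eq_refl) x hx), <- (hu (- w) (or_intror eq_refl) x hx).
  assert (he : exp (- w * x) * exp (w * x) = 1).
  { rewrite <- exp_plus, <- exp_0; f_equal; ring. }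
  rewrite Ropp_involutive.
  split.
  - transitivity (y x * (exp (- w * x) * exp (w * x))); [rewrite he; ring|field; lra].
  - transitivity (y' x * (exp (- w * x) * exp (w * x))); [rewrite he; ring|field; lra].
Qed.

Lemma ode_trig (lo hi : Rbar) (y y' : R -> R) (w : R) :
  Rbar_lt lo hi -> 0 < w ->
  (forall x, interval lo hi x -> is_derive y x (y' x) /\ is_derive y' x (- w ^ 2 * y x)) ->
  exists p q, forall x, interval lo hi x ->
    y x = p * cos (w * x) + q * sin (w * x) /\
    y' x = w * (q * cos (w * x) - p * sin (w * x)).
Proof.
  intros hlt hw hy; destruct (interval_nonempty _ _ hlt) as [x0 hx0].
  (* [P] and [Q] are the phase vector (y, y' / w) rotated back through the angle w x, which stops
     its motion. *)
  set (P := fun x => y x * cos (w * x) - y' x / w * sin (w * x)).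
  set (Q := fun x => y x * sin (w * x) + y' x / w * cos (w * x)).
  exists (P x0), (Q x0); intros x hx.
  assert (hP : P x0 = P x).
  { apply (derive_zero_constant lo hi P); auto.
    intros t ht; destruct (hy t ht) as [h h']; unfold P; auto_derive.
    - repeat split; eexists; eassumption.
    - derive_from_hyps; field; lra. }
  assert (hQ : Q x0 = Q x).
  { apply (derive_zero_constant lo hi Q); auto.
    intros t ht; destruct (hy t ht) as [h h']; unfold Q; auto_derive.
    - repeat split; eexists; eassumption.
    - derive_from_hyps; field; lra. }
  rewrite hP, hQ; unfold P, Q.
  pose proof (sin2_cos2 (w * x)) as h1; unfold Rsqr in h1.
  split.
  - transitivity (y x * (sin (w * x) * sin (w * x) + cos (w * x) * cos (w * x)));
      [rewrite h1; ring|field; lra].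
  - transitivity (y' x * (sin (w * x) * sin (w * x) + cos (w * x) * cos (w * x)));
      [rewrite h1; ring|field; lra].
Qed.

Lemma psi_of_ode (lo hi : Rbar) (y y' : R -> R) (K : R) :
  Rbar_lt lo hi ->
  (forall x, interval lo hi x -> is_derive y x (y' x) /\ is_derive y' x (K * y x)) ->
  exists d1 d2 d3 d4 d5 d6, forall x, interval lo hi x ->
    y x = psi d1 d2 d3 d4 d5 d6 K x.
Proof.
  intros hlt hy; unfold psi.
  destruct (Rlt_dec K 0) as [hK|hK]; [|destruct (Rlt_dec 0 K) as [hK'|hK']].
  - destruct (ode_trig lo hi y y' (sqrt (- K))) as (p & q & h); auto.
    + apply sqrt_lt_R0; lra.
    + intros x hx; rewrite pow2_sqrt, Ropp_involutive by lra; auto.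
    + exists 0, 0, 0, 0, q, p; intros x hx; rewrite (proj1 (h x hx)); ring.
  - destruct (ode_exp lo hi y y' (sqrt K)) as (p & q & h); auto.
    + apply sqrt_lt_R0; lra.
    + intros x hx; rewrite pow2_sqrt by lra; auto.
    + exists p, q, 0, 0, 0, 0; intros x hx; apply h; auto.
  - destruct (interval_nonempty _ _ hlt) as [x0 hx0].
    exists 0, 0, (y' x0), (y x0 - y' x0 * x0), 0, 0.
    apply (ode_zero lo hi y y'); auto.
    intros x hx; destruct (hy x hx) as [h h']; split; auto.
    apply (is_derive_eq _ _ _ _ h'); replace K with 0 by lra; ring.
Qed.

Lemma psi_ode (d1 d2 d3 d4 d5 d6 K : R) :
  exists y', forall x,
    is_derive (psi d1 d2 d3 d4 d5 d6 K) x (y' x) /\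
    is_derive y' x (K * psi d1 d2 d3 d4 d5 d6 K x).
Proof.
  unfold psi.
  destruct (Rlt_dec K 0) as [hK|hK]; [|destruct (Rlt_dec 0 K) as [hK'|hK']].
  - assert (hs : sqrt (- K) * sqrt (- K) = - K) by (apply sqrt_sqrt; lra).
    set (w := sqrt (- K)) in *.
    exists (fun x => d5 * (w * cos (w * x)) - d6 * (w * sin (w * x))).
    intros x; split; auto_derive; trivial; [ring|].
    replace K with (- (w * w)) by lra; ring.
  - assert (hs : sqrt K * sqrt K = K) by (apply sqrt_sqrt; lra).
    set (w := sqrt K) in *.
    exists (fun x => d1 * (w * exp (w * x)) - d2 * (w * exp (- w * x))).
    intros x; split; auto_derive; trivial; [ring|].
    rewrite <- hs; ring.
  - exists (fun _ => d3); intros x; split; auto_derive; trivial; [ring|].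
    replace K with 0 by lra; ring.
Qed.

(** * The curvature equation *)

(* With [q = 1 / w], the equation [2 q q'' - 3 q'^2 + 4 q^4 = 4 K q^2] reads
   [w'^2 - 2 w w'' + 4 = 4 K w^2]; it has the first integral
   [(w'^2 + 4 + 4 K w^2) / w = 2 c], along which it is the linear equation
   [w'' = c - 4 K w]. *)
Lemma curvature_ode_first_integral (lo hi : Rbar) (w w' w'' : R -> R) (K : R) :
  Rbar_lt lo hi ->
  (forall x, interval lo hi x ->
     0 < w x /\ is_derive w x (w' x) /\ is_derive w' x (w'' x) /\
     w' x ^ 2 - 2 * w x * w'' x + 4 = 4 * K * w x ^ 2) ->
  exists c, forall x, interval lo hi x ->
    w' x ^ 2 + 4 + 4 * K * w x ^ 2 = 2 * c * w x /\
    w'' x = c - 4 * K * w x.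
Proof.
  intros hlt hw; destruct (interval_nonempty _ _ hlt) as [x0 hx0].
  set (E := fun x => (w' x ^ 2 + 4 + 4 * K * w x ^ 2) / w x).
  exists (E x0 / 2).
  assert (hE : forall x, interval lo hi x -> E x = E x0).
  { intros x hx; apply (derive_zero_constant lo hi E); auto.
    intros t ht; destruct (hw t ht) as (h0 & h1 & h2 & h3); unfold E; auto_derive.
    - repeat split; try (eexists; eassumption); lra.
    - derive_from_hyps.
      transitivity (- w' t * (w' t ^ 2 - 2 * w t * w'' t + 4 - 4 * K * w t ^ 2) / w t ^ 2).
      + field; lra.
      + rewrite h3; field; lra. }
  intros x hx; destruct (hw x hx) as (h0 & h1 & h2 & h3).
  rewrite <- (hE x hx); unfold E; split; [field; lra|].
  (* The linear equation is read off from the original one by dividing by [2 * w x]. Differentiating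
     the first integral would instead require dividing by w', which may vanish. *)
  apply (Rmult_eq_reg_l (2 * w x)); [|lra].
  transitivity (w' x ^ 2 + 4 - 4 * K * w x ^ 2); [lra|field; lra].
Qed.

Lemma kappaN_of_ode (lo hi : Rbar) (w w' w'' : R -> R) (K : R) :
  Rbar_lt lo hi ->
  (forall x, interval lo hi x ->
     0 < w x /\ is_derive w x (w' x) /\ is_derive w' x (w'' x) /\
     w' x ^ 2 - 2 * w x * w'' x + 4 = 4 * K * w x ^ 2) ->
  exists sg C1 C2 C3 C4 C5, kappaN_constants sg C1 C2 C3 K /\
    forall x, interval lo hi x -> / w x = kappaN sg C1 C2 C3 C4 C5 K x.
Proof.
  intros hlt hw.
  destruct (curvature_ode_first_integral lo hi w w' w'' K hlt hw) as [c hc].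
  destruct (interval_nonempty _ _ hlt) as [x0 hx0].
  unfold kappaN, kappaN_constants, is_sign.
  destruct (Rlt_dec K 0) as [hK|hK]; [|destruct (Rlt_dec 0 K) as [hK'|hK']].
  (* [m] is the equilibrium of w'' = c - 4 K w, so w - m solves the homogeneous equation. *)
  - set (m := c / (4 * K)).
    assert (hs : 0 < sqrt (- K)) by (apply sqrt_lt_R0; lra).
    assert (hss : sqrt (- K) * sqrt (- K) = - K) by (apply sqrt_sqrt; lra).
    destruct (ode_exp lo hi (fun x => w x - m) w' (2 * sqrt (- K)))
      as (p & q & h); [auto|lra| |].
    { intros x hx; destruct (hw x hx) as (h0 & h1 & h2 & h3); split.
      - auto_derive; [eexists; eassumption|derive_from_hyps; ring].
      - apply (is_derive_eq _ _ _ _ h2); rewrite (proj2 (hc x hx)).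
        replace ((2 * sqrt (- K)) ^ 2) with (4 * (sqrt (- K) * sqrt (- K))) by ring.
        rewrite hss; unfold m; field; lra. }
    set (r := 2 * sqrt (- K)) in *.
    assert (hexp : forall x, exp (r * x) * exp (- r * x) = 1).
    { intros x; rewrite <- exp_plus, <- exp_0; f_equal; ring. }
    assert (hrr : r * r = - 4 * K) by (unfold r; nra).
    (* The first integral is evaluated at one point; the product of the two exponentials is 1, which
       leaves only p q. *)
    assert (hm : m * m = 4 * p * q + / K).
    { destruct (h x0 hx0) as [ha hb]; destruct (hc x0 hx0) as [hd _].
      rewrite hb in hd; replace (w x0) with (w x0 - m + m) in hd by ring.
      rewrite ha in hd.
      specialize (hexp x0).
      set (A := exp (r * x0)) in *; set (B := exp (- r * x0)) in *.
      assert (h5 : 4 * K * (m * m) = 16 * K * (p * q) + 4).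
      { replace c with (4 * K * m) in hd by (unfold m; field; lra).
        replace ((r * (p * A - q * B)) ^ 2)
          with ((r * r) * (p * A - q * B) ^ 2) in hd by ring.
        rewrite hrr in hd.
        replace (p * q) with (p * q * (A * B)) by (rewrite hexp; ring).
        lra. }
      apply (Rmult_eq_reg_l (4 * K)); [|lra].
      rewrite h5; field; lra. }
    assert (hpq : 0 < 4 * p * q).
    { assert (/ K < 0) by (apply Rinv_lt_0_compat; auto); nra. }
    assert (hp : 0 < p).
    (* If p and q were negative, w > 0 would give m > - (p A + q B) >= 0. Then m^2 > (p A + q B)^2
       >= 4 p q by the arithmetic-geometric mean inequality, against m^2 = 4 p q + 1/K with K <
       0. *)
    { destruct (Rlt_le_dec 0 p) as [|hp]; auto; exfalso.
      assert (hq : q < 0) by nra.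
      destruct (h x0 hx0) as [ha _]; destruct (hw x0 hx0) as [h0 _].
      specialize (hexp x0).
      pose proof (exp_pos (r * x0)); pose proof (exp_pos (- r * x0)).
      set (A := exp (r * x0)) in *; set (B := exp (- r * x0)) in *.
      assert (/ K < 0) by (apply Rinv_lt_0_compat; auto).
      assert (hmgt : - (p * A + q * B) < m) by lra.
      assert (0 <= - (p * A + q * B)) by nra.
      assert (h6 : (- (p * A + q * B)) * (- (p * A + q * B)) < m * m) by nra.
      assert (h7 : 4 * p * q = 4 * (p * A) * (q * B)).
      { transitivity (4 * p * q * (A * B)); [rewrite hexp; ring|ring]. }
      pose proof (pow2_ge_0 (p * A - q * B)); lra. }
    assert (hq : 0 < q) by nra.
    (* The sign of [m] is recorded in [sg], so that [sg] times sqrt(m^2) is [m]. [kappaN_constants]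
       asks for C3 > 0 whatever K is, hence the 1. *)
    exists (if Rle_dec 0 m then 1 else -1), p, q, 1, 0, 0; split.
    + repeat split; auto; try lra.
      * destruct (Rle_dec 0 m); auto.
      * intros _; rewrite <- hm; nra.
    + intros x hx; f_equal; rewrite <- hm.
      transitivity (w x - m + m); [ring|]; rewrite (proj1 (h x hx)).
      change (sqrt (m * m)) with (sqrt (Rsqr m)); rewrite sqrt_Rsqr_abs.
      fold r; replace (- 2 * sqrt (- K)) with (- r) by (unfold r; ring).
      destruct (Rle_dec 0 m); [rewrite Rabs_pos_eq by lra|rewrite Rabs_left by lra]; ring.
  - set (m := c / (4 * K)).
    assert (hs : 0 < sqrt K) by (apply sqrt_lt_R0; lra).
    assert (hss : sqrt K * sqrt K = K) by (apply sqrt_sqrt; lra).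
    destruct (ode_trig lo hi (fun x => w x - m) w' (2 * sqrt K))
      as (p & q & h); [auto|lra| |].
    { intros x hx; destruct (hw x hx) as (h0 & h1 & h2 & h3); split.
      - auto_derive; [eexists; eassumption|derive_from_hyps; ring].
      - apply (is_derive_eq _ _ _ _ h2); rewrite (proj2 (hc x hx)).
        replace ((2 * sqrt K) ^ 2) with (4 * (sqrt K * sqrt K)) by ring.
        rewrite hss; unfold m; field; lra. }
    set (r := 2 * sqrt K) in *.
    assert (hrr : r * r = 4 * K) by (unfold r; nra).
    assert (hm : m * m = / K + p ^ 2 + q ^ 2).
    { destruct (h x0 hx0) as [ha hb]; destruct (hc x0 hx0) as [hd _].
      rewrite hb in hd; replace (w x0) with (w x0 - m + m) in hd by ring.
      rewrite ha in hd.
      pose proof (sin2_cos2 (r * x0)) as htr; unfold Rsqr in htr.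
      set (A := cos (r * x0)) in *; set (B := sin (r * x0)) in *.
      assert (h5 : 4 * K * (m * m) = 4 * K * (p ^ 2 + q ^ 2) * (B * B + A * A) + 4).
      { replace c with (4 * K * m) in hd by (unfold m; field; lra).
        replace ((r * (q * A - p * B)) ^ 2)
          with ((r * r) * (q * A - p * B) ^ 2) in hd by ring.
        rewrite hrr in hd; lra. }
      rewrite htr in h5.
      apply (Rmult_eq_reg_l (4 * K)); [|lra].
      rewrite h5; field; lra. }
    (* 2 c w = w'^2 + 4 + 4 K w^2 > 0 forces c > 0, so the positive root is the right one. *)
    assert (hmpos : 0 < m).
    { destruct (hc x0 hx0) as [hd _]; destruct (hw x0 hx0) as [h0 _].
      assert (0 < c) by nra.
      unfold m; apply Rdiv_lt_0_compat; lra. }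
    exists 1, 1, 1, 1, p, q; split.
    + repeat split; auto; lra.
    + intros x hx; f_equal; rewrite <- hm.
      transitivity (w x - m + m); [ring|]; rewrite (proj1 (h x hx)).
      change (sqrt (m * m)) with (sqrt (Rsqr m)); rewrite sqrt_Rsqr by lra.
      reflexivity.
  - assert (hK0 : K = 0) by lra; subst K.
    assert (hcpos : 0 < c).
    { destruct (hc x0 hx0) as [hd _]; destruct (hw x0 hx0) as [h0 _].
      pose proof (pow2_ge_0 (w' x0)); nra. }
    assert (hlin : forall x, interval lo hi x -> w' x = c * x + (w' x0 - c * x0)).
    { intros x hx.
      assert (h : w' x - c * x = w' x0 - c * x0); [|lra].
      apply (derive_zero_constant lo hi (fun t => w' t - c * t)); auto.
      intros t ht; destruct (hw t ht) as (h0 & h1 & h2 & h3); auto_derive.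
      - repeat split; eexists; eassumption.
      - derive_from_hyps; rewrite (proj2 (hc t ht)); ring. }
    (* With C3 = 2 c and w' = c (x + C4), the value 1 / w = 2 c / (w'^2 + 4) becomes the stated
       fraction. *)
    exists 1, 1, 1, (2 * c), ((w' x0 - c * x0) / c), 0; split.
    + repeat split; auto; lra.
    + intros x hx; destruct (hc x hx) as [hd _]; destruct (hw x hx) as [h0 _].
      assert (hwx : w x = (w' x ^ 2 + 4) / (2 * c)).
      { apply (Rmult_eq_reg_l (2 * c)); [|lra].
        transitivity (w' x ^ 2 + 4); [lra|field; lra]. }
      rewrite hwx.
      replace (x + (w' x0 - c * x0) / c) with (w' x / c) by (rewrite hlin by auto; field; lra).
      pose proof (pow2_ge_0 (w' x)).
      field; repeat split; nra.
Qed.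

(** Converse of [kappaN_of_ode], valid on the whole line: for every admissible choice of constants
    the denominator is positive everywhere. *)
Lemma kappaN_ode (sg C1 C2 C3 C4 C5 K : R) :
  kappaN_constants sg C1 C2 C3 K ->
  exists w w' w'' : R -> R, forall x,
    kappaN sg C1 C2 C3 C4 C5 K x = / w x /\
    0 < w x /\ is_derive w x (w' x) /\ is_derive w' x (w'' x) /\
    w' x ^ 2 - 2 * w x * w'' x + 4 = 4 * K * w x ^ 2.
Proof.
  intros (hsg & h1 & h2 & h3 & hroot); unfold kappaN.
  destruct (Rlt_dec K 0) as [hK|hK]; [|destruct (Rlt_dec 0 K) as [hK'|hK']].
  - specialize (hroot hK).
    assert (hss : sqrt (- K) * sqrt (- K) = - K) by (apply sqrt_sqrt; lra).
    set (r := sqrt (- K)) in *.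
    assert (hm : (sg * sqrt (4 * C1 * C2 + / K)) * (sg * sqrt (4 * C1 * C2 + / K))
      = 4 * C1 * C2 + / K).
    { transitivity (sg * sg * (sqrt (4 * C1 * C2 + / K) * sqrt (4 * C1 * C2 + / K)));
        [ring|].
      rewrite sqrt_sqrt by auto; destruct hsg as [-> | ->]; ring. }
    set (m := sg * sqrt (4 * C1 * C2 + / K)) in *.
    exists (fun x => C1 * exp (2 * r * x) + C2 * exp (- 2 * r * x) + m),
      (fun x => 2 * r * (C1 * exp (2 * r * x) - C2 * exp (- 2 * r * x))),
      (fun x => 4 * (r * r) * (C1 * exp (2 * r * x) + C2 * exp (- 2 * r * x))).
    intros x.
    assert (he : exp (2 * r * x) * exp (- 2 * r * x) = 1).
    { rewrite <- exp_plus, <- exp_0; f_equal; ring. }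
    split; [reflexivity|split; [|split; [|split]]].
    (* m^2 < 4 C1 C2 = 4 (C1 P) (C2 Q) <= (C1 P + C2 Q)^2, so the exponential part outweighs m for
       either sign. *)
    + pose proof (exp_pos (2 * r * x)); pose proof (exp_pos (- 2 * r * x)).
      set (P := exp (2 * r * x)) in *; set (Q := exp (- 2 * r * x)) in *.
      assert (/ K < 0) by (apply Rinv_lt_0_compat; auto).
      assert (0 < C1 * P) by (apply Rmult_lt_0_compat; auto).
      assert (0 < C2 * Q) by (apply Rmult_lt_0_compat; auto).
      assert (hPQ : 4 * C1 * C2 = 4 * (C1 * P) * (C2 * Q)).
      { transitivity (4 * C1 * C2 * (P * Q)); [rewrite he; ring|ring]. }
      pose proof (pow2_ge_0 (C1 * P - C2 * Q)).
      nra.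
    + auto_derive; trivial; ring.
    + auto_derive; trivial; ring.
    + set (P := exp (2 * r * x)) in *; set (Q := exp (- 2 * r * x)) in *.
      replace ((2 * r * (C1 * P - C2 * Q)) ^ 2)
        with (4 * (r * r) * (C1 * P - C2 * Q) ^ 2) by ring.
      rewrite hss.
      assert (hmK : 4 * K * (m * m) = 16 * K * C1 * C2 * (P * Q) + 4)
        by (rewrite hm, he; field; lra).
      lra.
  - assert (hss : sqrt K * sqrt K = K) by (apply sqrt_sqrt; lra).
    set (r := sqrt K) in *.
    assert (hKi : 0 < / K) by (apply Rinv_0_lt_compat; auto).
    pose proof (pow2_ge_0 C4); pose proof (pow2_ge_0 C5).
    assert (hm : sqrt (/ K + C4 ^ 2 + C5 ^ 2) * sqrt (/ K + C4 ^ 2 + C5 ^ 2)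
      = / K + C4 ^ 2 + C5 ^ 2) by (apply sqrt_sqrt; lra).
    assert (hmpos : 0 < sqrt (/ K + C4 ^ 2 + C5 ^ 2)) by (apply sqrt_lt_R0; lra).
    set (m := sqrt (/ K + C4 ^ 2 + C5 ^ 2)) in *.
    exists (fun x => C4 * cos (2 * r * x) + C5 * sin (2 * r * x) + m),
      (fun x => 2 * r * (C5 * cos (2 * r * x) - C4 * sin (2 * r * x))),
      (fun x => - 4 * (r * r) * (C4 * cos (2 * r * x) + C5 * sin (2 * r * x))).
    intros x.
    pose proof (sin2_cos2 (2 * r * x)) as htr; unfold Rsqr in htr.
    split; [reflexivity|split; [|split; [|split]]].
    (* Cauchy-Schwarz: the square of the oscillating part is at most C4^2 + C5^2, which is less than
       m^2. *)
    + set (P := cos (2 * r * x)) in *; set (Q := sin (2 * r * x)) in *.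
      assert (hCS : (C4 * P + C5 * Q) ^ 2 + (C4 * Q - C5 * P) ^ 2 = C4 ^ 2 + C5 ^ 2).
      { transitivity ((C4 ^ 2 + C5 ^ 2) * (Q * Q + P * P)); [ring|rewrite htr; ring]. }
      pose proof (pow2_ge_0 (C4 * Q - C5 * P)).
      nra.
    + auto_derive; trivial; ring.
    + auto_derive; trivial; ring.
    + set (P := cos (2 * r * x)) in *; set (Q := sin (2 * r * x)) in *.
      replace ((2 * r * (C5 * P - C4 * Q)) ^ 2)
        with (4 * (r * r) * (C5 * P - C4 * Q) ^ 2) by ring.
      rewrite hss.
      assert (hmK : 4 * K * (m * m)
        = 4 + 4 * K * (C4 ^ 2 + C5 ^ 2) * (Q * Q + P * P))
        by (rewrite hm, htr; field; lra).
      lra.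
  - exists (fun x => (16 + C3 ^ 2 * (x + C4) ^ 2) / (4 * C3)),
      (fun x => C3 * (x + C4) / 2), (fun _ => C3 / 2).
    intros x; pose proof (pow2_ge_0 (C3 * (x + C4))).
    assert (0 < 16 + C3 ^ 2 * (x + C4) ^ 2) by nra.
    split; [field; split; lra|split; [|split; [|split]]].
    + apply Rdiv_lt_0_compat; lra.
    + auto_derive; trivial; field; lra.
    + auto_derive; trivial; field.
    + replace K with 0 by lra; field; lra.
Qed.

(** * Separation of variables *)

Lemma is_derive_Rpower_comp (q : R -> R) (s q' c : R) :
  0 < q s -> is_derive q s q' ->
  is_derive (fun t => Rpower (q t) c) s (Rpower (q s) c * (c * q' / q s)).
Proof.
  intros hpos hq; unfold Rpower; auto_derive.
  - split; [eexists; eassumption|auto].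
  - derive_from_hyps; field; lra.
Qed.

(* Logarithmic derivatives turn the normal equation for [k = e q] and
   [f = p(v) q(s)^(-3/2)] into [p'' / p = q'' / (2 q) - 3 q'^2 / (4 q^2) + q^2]. *)
Lemma separated_equations (s0 s1 v0 v1 : Rbar) (f : R -> R -> R)
    (q q' q'' p p' p'' : R -> R) :
  (forall s, interval s0 s1 s ->
     0 < q s /\ is_derive q s (q' s) /\ is_derive q' s (q'' s)) ->
  (forall v, interval v0 v1 v -> is_derive p v (p' v) /\ is_derive p' v (p'' v)) ->
  (forall s v, interval s0 s1 s -> interval v0 v1 v ->
     f s v = p v * Rpower (q s) (- 3 / 2)) ->
  forall s v, interval s0 s1 s -> interval v0 v1 v ->
    3 * f s v * q' s + 2 * pd cs f s v * q s = 0 /\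
    f s v * (q'' s - q s ^ 3) + (pd cs (pd cs f) s v + pd cv (pd cv f) s v) * q s
      + 2 * pd cs f s v * q' s
    = Rpower (q s) (- 3 / 2) * q s *
      (p'' v - p v * (q'' s / (2 * q s) - 3 / 4 * (q' s / q s) ^ 2 + q s ^ 2)).
Proof.
  intros hq hp hf s v hs hv.
  assert (hfs : forall t, interval s0 s1 t ->
    pd cs f t v = p v * (Rpower (q t) (- 3 / 2) * (- 3 / 2 * q' t / q t))).
  { intros t ht; destruct (hq t ht) as (h0 & h1 & h2); simpl.
    rewrite (Derive_eq_on s0 s1 _ (fun t => p v * Rpower (q t) (- 3 / 2))) by auto.
    rewrite Derive_scal; f_equal.
    apply is_derive_unique, is_derive_Rpower_comp; auto. }
  (* With rho = q^(-3/2), rho'' / rho = (rho' / rho)^2 + (rho' / rho)'; here 15/4 = 9/4 + 3/2. *)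
  assert (hfss : pd cs (pd cs f) s v =
    p v * Rpower (q s) (- 3 / 2)
      * (15 / 4 * (q' s / q s) ^ 2 - 3 / 2 * (q'' s / q s))).
  { destruct (hq s hs) as (h0 & h1 & h2).
    set (rho := fun t => Rpower (q t) (- 3 / 2)).
    assert (h3 : is_derive rho s (rho s * (- 3 / 2 * q' s / q s)))
      by (apply is_derive_Rpower_comp; auto).
    transitivity (Derive (fun t => p v * (rho t * (- 3 / 2 * q' t / q t))) s).
    - apply Derive_eq_on with s0 s1; auto.
    - apply is_derive_unique; auto_derive.
      + repeat split; try (eexists; eassumption); lra.
      + derive_from_hyps.
        change (Rpower (q s) (- 3 / 2)) with (rho s); field; lra. }
  assert (hfvv : pd cv (pd cv f) s v = p'' v * Rpower (q s) (- 3 / 2)).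
  { simpl; transitivity (Derive (fun r => p' r * Rpower (q s) (- 3 / 2)) v).
    - apply Derive_eq_on with v0 v1; auto.
      intros r hr; destruct (hp r hr) as [h1 h2].
      rewrite (Derive_eq_on v0 v1 _ (fun r => p r * Rpower (q s) (- 3 / 2))) by auto.
      rewrite Derive_scal_l; f_equal; apply is_derive_unique; auto.
    - rewrite Derive_scal_l; f_equal; apply is_derive_unique, hp; auto. }
  destruct (hq s hs) as (h0 & h1 & h2).
  rewrite hfss, hfvv, hfs, hf by auto; split; field; lra.
Qed.

Lemma smooth_partials (M : R -> R -> Prop) (f : R -> R -> R) (s v : R) :
  smooth M f -> M s v ->
  ex_derive (fun t => f t v) s /\ ex_derive (fun t => f s t) v /\
  ex_derive (fun t => pd cv f s t) v.
Proof.
  (* [ex_diff_n] at order 2 lists continuity, the two first partial derivatives, and then the same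
     data at order 1 for each of them; [h3] comes from the one in [v]. *)
  intros hf hM; destruct (hf 2%nat s v hM) as (_ & h1 & h2 & _ & _ & _ & h3 & _).
  auto.
Qed.

(** The derivative of f^2 k^3 in s is f k times the tangential equation, so constancy follows
    without dividing by k, which may not yet be assumed nonzero. As f^2 > 0, the sign of k at [t]
    then spreads to the whole interval. *)
Lemma curvature_sign (s0 s1 v0 v1 : Rbar) (f : R -> R -> R) (k k' : R -> R) (t : R) :
  Rbar_lt v0 v1 ->
  smooth (rectangle (interval s0 s1) (interval v0 v1)) f ->
  (forall s v, interval s0 s1 s -> interval v0 v1 v -> 0 < f s v) ->
  (forall s, interval s0 s1 s -> is_derive k s (k' s)) ->
  (forall s v, interval s0 s1 s -> interval v0 v1 v ->
     3 * f s v * k s * k' s + 2 * pd cs f s v * k s ^ 2 = 0) ->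
  interval s0 s1 t -> k t <> 0 ->
  exists e, is_sign e /\ forall s, interval s0 s1 s -> 0 < e * k s.
Proof.
  intros hlt hsm hpos hk heq ht hkt.
  destruct (interval_nonempty _ _ hlt) as [v hv].
  assert (hc : forall s, interval s0 s1 s ->
    f s v * f s v * (k s * k s * k s) = f t v * f t v * (k t * k t * k t)).
  { intros s hs.
    apply (derive_zero_constant s0 s1 (fun s => f s v * f s v * (k s * k s * k s))); auto.
    intros x hx; pose proof (hk x hx) as h1.
    destruct (smooth_partials _ f x v hsm (conj hx hv)) as [h2 _].
    apply Derive_correct in h2; change (is_derive (fun t => f t v) x (pd cs f x v)) in h2.
    pose proof (is_derive_Rmult _ _ _ _ _ (is_derive_Rmult _ _ _ _ _ h2 h2)
      (is_derive_Rmult _ _ _ _ _ (is_derive_Rmult _ _ _ _ _ h1 h1) h1)) as h3.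
    apply (is_derive_eq _ _ _ _ h3).
    pose proof (heq x v hx hv) as h4.
    transitivity (f x v * k x * (3 * f x v * k x * k' x
      + 2 * pd cs f x v * k x ^ 2)); [ring|].
    rewrite h4; ring. }
  assert (hcube : forall x, 0 < x * x * x -> 0 < x)
    by (intros x hx; destruct (Rlt_le_dec 0 x); auto; nra).
  destruct (Rlt_le_dec 0 (k t)) as [hk0|hk0].
  - exists 1; split; [left; reflexivity|].
    intros s hs; rewrite Rmult_1_l; apply hcube.
    pose proof (hpos s v hs hv); pose proof (hpos t v ht hv).
    assert (0 < f t v * f t v * (k t * k t * k t))
      by (repeat apply Rmult_lt_0_compat; auto).
    apply (Rmult_lt_reg_l (f s v * f s v)); [apply Rmult_lt_0_compat; auto|].
    rewrite Rmult_0_r, hc; auto.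
  - exists (-1); split; [right; reflexivity|].
    intros s hs; apply hcube.
    pose proof (hpos s v hs hv); pose proof (hpos t v ht hv).
    assert (0 < f t v * f t v * (- k t * - k t * - k t))
      by (repeat apply Rmult_lt_0_compat; auto; lra).
    apply (Rmult_lt_reg_l (f s v * f s v)); [apply Rmult_lt_0_compat; auto|].
    specialize (hc s hs); lra.
Qed.

Lemma separation (s0 s1 v0 v1 : Rbar) (f : R -> R -> R) (q q' q'' : R -> R) :
  Rbar_lt s0 s1 -> Rbar_lt v0 v1 ->
  smooth (rectangle (interval s0 s1) (interval v0 v1)) f ->
  (forall s v, interval s0 s1 s -> interval v0 v1 v -> 0 < f s v) ->
  (forall s, interval s0 s1 s ->
     0 < q s /\ is_derive q s (q' s) /\ is_derive q' s (q'' s)) ->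
  (forall s v, interval s0 s1 s -> interval v0 v1 v ->
     3 * f s v * q' s + 2 * pd cs f s v * q s = 0 /\
     f s v * (q'' s - q s ^ 3) + (pd cs (pd cs f) s v + pd cv (pd cv f) s v) * q s
       + 2 * pd cs f s v * q' s = 0) ->
  exists K p p',
    (forall v, interval v0 v1 v -> is_derive p v (p' v) /\ is_derive p' v (K * p v)) /\
    (forall s v, interval s0 s1 s -> interval v0 v1 v ->
       f s v = p v * Rpower (q s) (- 3 / 2)) /\
    (forall s, interval s0 s1 s ->
       q'' s / (2 * q s) - 3 / 4 * (q' s / q s) ^ 2 + q s ^ 2 = K).
Proof.
  intros hIlt hJlt hsm hpos hq heq.
  destruct (interval_nonempty _ _ hIlt) as [t ht].
  destruct (interval_nonempty _ _ hJlt) as [r hr].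
  set (F := fun s => q'' s / (2 * q s) - 3 / 4 * (q' s / q s) ^ 2 + q s ^ 2).
  (* f q^(3/2) does not depend on s, so its value at the base point [t] defines p(v). *)
  set (c := Rpower (q t) (3 / 2)).
  set (p := fun v => f t v * c); set (p' := fun v => pd cv f t v * c).
  assert (hp : forall v, interval v0 v1 v ->
    is_derive p v (p' v) /\ is_derive p' v (pd cv (pd cv f) t v * c)).
  { intros v hv; destruct (smooth_partials _ f t v hsm (conj ht hv)) as (_ & h1 & h2).
    split; apply (is_derive_scal_l (V := R_NormedModule)), Derive_correct; assumption. }
  assert (hf : forall s v, interval s0 s1 s -> interval v0 v1 v ->
    f s v = p v * Rpower (q s) (- 3 / 2)).
  { intros s v hs hv; unfold p, c.
    rewrite <- (derive_zero_constant s0 s1 (fun s => f s v * Rpower (q s) (3 / 2)))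
      with (x := s); auto.
    - rewrite Rmult_assoc, <- Rpower_plus.
      replace (3 / 2 + - 3 / 2) with 0 by field.
      rewrite Rpower_O by (apply hq; auto); ring.
    - intros x hx; destruct (hq x hx) as (h0 & h1 & h2).
      destruct (smooth_partials _ f x v hsm (conj hx hv)) as [h3 _].
      apply Derive_correct in h3; change (is_derive (fun t => f t v) x (pd cs f x v)) in h3.
      apply (is_derive_eq _ _ _ _ (is_derive_Rmult _ _ _ _ _ h3
        (is_derive_Rpower_comp q x (q' x) (3 / 2) h0 h1))).
      destruct (heq x v hx hv) as [h4 _].
          transitivity (Rpower (q x) (3 / 2) / (2 * q x)
        * (3 * f x v * q' x + 2 * pd cs f x v * q x)); [field; lra|].
      rewrite h4; ring. }
  assert (hF : forall s v, interval s0 s1 s -> interval v0 v1 v ->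
    pd cv (pd cv f) t v * c = F s * p v).
  { intros s v hs hv.
    destruct (separated_equations s0 s1 v0 v1 f q q' q'' p p' _ hq hp hf s v hs hv)
      as [_ h].
    rewrite (proj2 (heq s v hs hv)) in h; fold (F s) in h.
    pose proof (exp_pos (- 3 / 2 * ln (q s))) as hrho; fold (Rpower (q s) (- 3 / 2)) in hrho.
    destruct (hq s hs) as [h0 _].
    symmetry in h; apply Rmult_integral in h; destruct h as [h|h]; [|lra].
    apply Rmult_integral in h; lra. }
  exists (F t), p, p'; split; [|split]; auto.
  - intros v hv; destruct (hp v hv) as [h1 h2]; split; auto.
    rewrite <- (hF t v ht hv); exact h2.
  - intros s hs; fold (F s).
    (* p'' = F(s) p for every s; since p(r) > 0, comparing at v = r gives F(s) = F(t). *)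
    apply (Rmult_eq_reg_r (p r)).
    + rewrite <- (hF s r hs hr); apply (hF t r ht hr).
    + pose proof (exp_pos (3 / 2 * ln (q t))) as hrho; fold (Rpower (q t) (3 / 2)) in hrho.
      pose proof (hpos t r ht hr); unfold p, c; nra.
Qed.

(** * The classification *)

(** Serves the substitution w = 1 / q in both directions, from the curvature to w and from w back to
    the curvature. *)
Lemma inverse_derives (q q' : R -> R) (s q'' : R) :
  0 < q s -> is_derive q s (q' s) -> is_derive q' s q'' ->
  is_derive (fun t => / q t) s (- q' s / q s ^ 2) /\
  is_derive (fun t => - q' t / q t ^ 2) s (2 * q' s ^ 2 / q s ^ 3 - q'' / q s ^ 2).
Proof.
  intros h0 h1 h2.
  split; auto_derive.
  - split; [eexists; eassumption|split; auto; lra].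
  - derive_from_hyps; field; lra.
  - repeat split; try (eexists; eassumption).
    apply Rgt_not_eq; pose proof (Rmult_lt_0_compat _ _ h0 h0); simpl; lra.
  - derive_from_hyps; field; lra.
Qed.

Lemma proper_f_biharmonic_classification (s0 s1 v0 v1 : Rbar) (a : R -> R3) (b : R3)
    (f : R -> R -> R) :
  Rbar_lt s0 s1 -> Rbar_lt v0 v1 -> unit_speed_orthogonal s0 s1 a b ->
  smooth (rectangle (interval s0 s1) (interval v0 v1)) f ->
  (forall s v, interval s0 s1 s -> interval v0 v1 v -> 0 < f s v) ->
  proper_f_biharmonic_surface (rectangle (interval s0 s1) (interval v0 v1)) f
    (cylinder a b) ->
  circular_case (interval s0 s1) (interval v0 v1) a b f \/
  nonconstant_case (interval s0 s1) (interval v0 v1) a b f.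
Proof.
  intros hI hJ ha hsm hpos [hfb hnb].
  rewrite (biharmonic_cylinder_iff s0 s1 v0 v1) in hnb by auto.
  rewrite f_biharmonic_cylinder_iff in hfb by auto.
  pose proof (fun s => kappa1_derives s0 s1 a b s ha) as hk.
  pose proof (fun s v => cylinder_H_eq s0 s1 a b s v ha) as hH.
  assert (ht : exists t, interval s0 s1 t /\ kappa1 a b t <> 0).
  { apply NNPP; intros hn; apply hnb; intros s hs.
    apply NNPP; intros h; apply hn; eauto. }
  destruct ht as (t & ht & hkt).
  destruct (curvature_sign s0 s1 v0 v1 f (kappa1 a b) (Derive (kappa1 a b)) t)
    as (e & he & hq); auto.
  { intros s hs; apply hk; auto. }
  { intros s v hs hv; apply hfb; auto. }
  assert (hee : e * e = 1) by (destruct he as [-> | ->]; ring).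
  set (q := fun s => e * kappa1 a b s).
  set (q' := fun s => e * Derive (kappa1 a b) s).
  set (q'' := fun s => e * Derive (Derive (kappa1 a b)) s).
  assert (hqd : forall s, interval s0 s1 s ->
    0 < q s /\ is_derive q s (q' s) /\ is_derive q' s (q'' s)).
  { intros s hs; destruct (hk s hs) as [h1 h2].
    split; [exact (hq s hs)|split]; apply is_derive_scal; auto. }
  destruct (separation s0 s1 v0 v1 f q q' q'') as (K & p & p' & hp & hf & hF); auto.
  { intros s v hs hv; destruct (hfb s v hs hv) as [hN hT]; destruct (hqd s hs) as [h0 _].
    unfold q, q', q'' in *; split.
    (* As e^2 = 1, the tangential equation for k is q times the one for q, and q > 0 cancels. *)
    - apply (Rmult_eq_reg_l (e * kappa1 a b s)); [|lra].
      rewrite Rmult_0_r, <- (Rmult_0_r (e * e)), <- hT; ring.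
    - rewrite <- (Rmult_0_r e), <- hN.
      (* The factor e^2 inserted before k^3 makes the cubic term equal to q^3 after multiplication
         by e. *)
      transitivity (e * (f s v * (Derive (Derive (kappa1 a b)) s
          - (e * e) * kappa1 a b s ^ 3)
        + (pd cs (pd cs f) s v + pd cv (pd cv f) s v) * kappa1 a b s
        + 2 * pd cs f s v * Derive (kappa1 a b) s)); [ring|rewrite hee; ring]. }
  destruct (psi_of_ode v0 v1 p p' K hJ hp) as (d1 & d2 & d3 & d4 & d5 & d6 & hpsi).
  destruct (classic (exists k, forall s, interval s0 s1 s -> kappa1 a b s = k))
    as [[k hconst]|hnc].
  - left; exists k.
    assert (hk0 : k <> 0) by (rewrite <- (hconst t ht); auto).
    assert (hek : 0 < e * k) by (rewrite <- (hconst t ht); auto).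
    (* For constant q the separation constant is q^2, hence K > 0 and sqrt K = e k = |k|. *)
    assert (hK : K = k ^ 2).
    { rewrite <- (hF t ht); unfold q'', q', q.
      assert (hd : forall s, interval s0 s1 s -> Derive (kappa1 a b) s = 0).
      { intros s hs; rewrite (Derive_eq_on s0 s1 _ (fun _ => k)) by auto.
        apply Derive_const. }
      rewrite (Derive_eq_on s0 s1 (Derive (kappa1 a b)) (fun _ => 0)) by auto.
      rewrite Derive_const, hd, hconst by auto.
      transitivity (e * e * k ^ 2); [|rewrite hee; ring].
      field; split; intros h0; rewrite h0 in hek; lra. }
    assert (hsq : sqrt K = e * k).
    { rewrite hK; replace (k ^ 2) with (Rsqr (e * k)).
      - apply sqrt_Rsqr; lra.
      - unfold Rsqr; transitivity (e * e * k ^ 2); [ring|rewrite hee; ring]. }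
    assert (hK0 : 0 < K) by (rewrite hK; apply pow2_gt_0; auto).
    repeat split; auto.
    + apply in_circle_of_constant_kappa1 with b; auto.
    + intros s v hs hv; rewrite hH, hconst by auto; reflexivity.
    + assert (hf' : forall s v, interval s0 s1 s -> interval v0 v1 v ->
        f s v = (d1 * exp (e * k * v) + d2 * exp (- (e * k) * v))
                * Rpower (e * k) (- 3 / 2)).
      { intros s v hs hv; rewrite hf, hpsi by auto.
        unfold psi, q; rewrite hconst, hsq by auto.
        destruct (Rlt_dec K 0); [lra|]; destruct (Rlt_dec 0 K); [reflexivity|lra]. }
      (* The constant factor [rho] is absorbed into d1 and d2; for e = -1 the two exponentials trade
         places. *)
      set (rho := Rpower (e * k) (- 3 / 2)) in *.
      destruct he as [-> | ->].
      * exists (d1 * rho), (d2 * rho); intros s v hs hv; rewrite hf' by auto.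
        rewrite Rmult_1_l; ring.
      * exists (d2 * rho), (d1 * rho); intros s v hs hv; rewrite hf' by auto.
        replace (- (-1 * k)) with k by ring.
        replace (-1 * k) with (- k) by ring; ring.
  - right; split; auto.
    destruct (kappaN_of_ode s0 s1 (fun s => / q s) (fun s => - q' s / q s ^ 2)
      (fun s => 2 * q' s ^ 2 / q s ^ 3 - q'' s / q s ^ 2) K)
      as (sg & C1 & C2 & C3 & C4 & C5 & hC & hkN); auto.
    { intros s hs; destruct (hqd s hs) as (h0 & h1 & h2).
      destruct (inverse_derives q q' s (q'' s) h0 h1 h2) as [h3 h4].
      split; [apply Rinv_0_lt_compat; auto|split; [auto|split; auto]].
      rewrite <- (hF s hs); field; lra. }
    assert (hqN : forall s, interval s0 s1 s -> q s = kappaN sg C1 C2 C3 C4 C5 K s)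
      by (intros s hs; rewrite <- hkN, Rinv_inv by auto; reflexivity).
    assert (hkap : forall s, interval s0 s1 s ->
      kappa1 a b s = e * kappaN sg C1 C2 C3 C4 C5 K s).
    { intros s hs; rewrite <- hqN by auto; unfold q.
      transitivity (e * e * kappa1 a b s); [rewrite hee; ring|ring]. }
    exists K, e, sg, C1, C2, C3, C4, C5, d1, d2, d3, d4, d5, d6.
    split; [auto|split; [auto|split; [auto|split; [|split]]]].
    + intros s hs; apply kappa2_cylinder with s0 s1; auto.
    + intros s v hs hv; rewrite hH, hkap by auto; reflexivity.
    + intros s v hs hv; rewrite hf, hpsi, hqN by auto; reflexivity.
Qed.

Lemma circular_case_proper (s0 s1 v0 v1 : Rbar) (a : R -> R3) (b : R3)
    (f : R -> R -> R) :
  Rbar_lt s0 s1 -> Rbar_lt v0 v1 -> unit_speed_orthogonal s0 s1 a b ->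
  circular_case (interval s0 s1) (interval v0 v1) a b f ->
  proper_f_biharmonic_surface (rectangle (interval s0 s1) (interval v0 v1)) f
    (cylinder a b).
Proof.
  intros hI hJ ha (k & hk0 & hk & _ & _ & d1 & d2 & hf).
  split.
  - apply f_biharmonic_cylinder_iff; auto; intros s v hs hv.
    assert (hd : forall t, interval s0 s1 t -> Derive (kappa1 a b) t = 0).
    { intros t ht; rewrite (Derive_eq_on s0 s1 _ (fun _ => k)) by auto.
      apply Derive_const. }
    assert (hfs : forall t, interval s0 s1 t -> pd cs f t v = 0).
    { intros t ht; simpl.
      rewrite (Derive_eq_on s0 s1 _ (fun _ => d1 * exp (k * v) + d2 * exp (- k * v)))
        by auto.
      apply Derive_const. }
    assert (hfss : pd cs (pd cs f) s v = 0).
    { transitivity (Derive (fun _ => 0) s); [|apply Derive_const].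
      apply Derive_eq_on with s0 s1; auto. }
    assert (hfvv : pd cv (pd cv f) s v = k ^ 2 * f s v).
    { transitivity (Derive (fun r => d1 * (k * exp (k * r)) - d2 * (k * exp (- k * r))) v).
      - apply Derive_eq_on with v0 v1; auto; intros r hr; simpl.
        rewrite (Derive_eq_on v0 v1 _ (fun r => d1 * exp (k * r) + d2 * exp (- k * r)))
          by auto.
        apply is_derive_unique; auto_derive; trivial; ring.
      - rewrite hf by auto; apply is_derive_unique; auto_derive; trivial; ring. }
    rewrite (Derive_eq_on s0 s1 (Derive (kappa1 a b)) (fun _ => 0)) by auto.
    rewrite Derive_const, hd, hk, hfs, hfss, hfvv by auto; split; ring.
  - rewrite (biharmonic_cylinder_iff s0 s1 v0 v1) by auto; intros h.
    destruct (interval_nonempty _ _ hI) as [t ht].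
    apply hk0; rewrite <- (hk t ht); auto.
Qed.

Lemma nonconstant_case_proper (s0 s1 v0 v1 : Rbar) (a : R -> R3) (b : R3)
    (f : R -> R -> R) :
  Rbar_lt s0 s1 -> Rbar_lt v0 v1 -> unit_speed_orthogonal s0 s1 a b ->
  nonconstant_case (interval s0 s1) (interval v0 v1) a b f ->
  proper_f_biharmonic_surface (rectangle (interval s0 s1) (interval v0 v1)) f
    (cylinder a b).
Proof.
  intros hI hJ ha (hnc & K & e & sg & C1 & C2 & C3 & C4 & C5 & d1 & d2 & d3 & d4 & d5 & d6
    & he & hC & hk & _ & _ & hf).
  assert (hee : e * e = 1) by (destruct he as [-> | ->]; ring).
  destruct (kappaN_ode sg C1 C2 C3 C4 C5 K hC) as (w & w' & w'' & hw).
  destruct (psi_ode d1 d2 d3 d4 d5 d6 K) as (p' & hp).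
  set (q := kappaN sg C1 C2 C3 C4 C5 K) in *.
  set (p := psi d1 d2 d3 d4 d5 d6 K) in *.
  set (q' := fun s => - w' s / w s ^ 2).
  set (q'' := fun s => 2 * w' s ^ 2 / w s ^ 3 - w'' s / w s ^ 2).
  assert (hq : forall s, 0 < q s /\ is_derive q s (q' s) /\ is_derive q' s (q'' s)).
  { intros s; destruct (hw s) as (h & h0 & h1 & h2 & _).
    destruct (inverse_derives w w' s (w'' s) h0 h1 h2) as [h3 h4].
    split; [rewrite h; apply Rinv_0_lt_compat; auto|split; auto].
    apply (is_derive_ext (fun t => / w t)); auto.
    intros t; symmetry; apply hw. }
  assert (hF : forall s, q'' s / (2 * q s) - 3 / 4 * (q' s / q s) ^ 2 + q s ^ 2 = K).
  { intros s; destruct (hw s) as (h & h0 & _ & _ & h1).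
    rewrite h; unfold q', q''.
    transitivity ((w' s ^ 2 - 2 * w s * w'' s + 4) / (4 * w s ^ 2)); [field; lra|].
    rewrite h1; field; lra. }
  split.
  - apply f_biharmonic_cylinder_iff; auto; intros s v hs hv.
    assert (hd1 : forall t, interval s0 s1 t -> Derive (kappa1 a b) t = e * q' t).
    { intros t ht; rewrite (Derive_eq_on s0 s1 _ (fun t => e * q t)) by auto.
      rewrite Derive_scal; f_equal; apply is_derive_unique, hq. }
    assert (hd2 : Derive (Derive (kappa1 a b)) s = e * q'' s).
    { rewrite (Derive_eq_on s0 s1 _ (fun t => e * q' t)) by auto.
      rewrite Derive_scal; f_equal; apply is_derive_unique, hq. }
    destruct (separated_equations s0 s1 v0 v1 f q q' q'' p p' (fun v => K * p v))
      with (s := s) (v := v) as [hT hN]; auto.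
    rewrite hF in hN; rewrite hd2, hd1, hk by auto.
    split.
    + transitivity (e * (f s v * (q'' s - (e * e) * q s ^ 3)
        + (pd cs (pd cs f) s v + pd cv (pd cv f) s v) * q s
        + 2 * pd cs f s v * q' s)); [ring|].
      rewrite hee, Rmult_1_l, hN; ring.
    + transitivity (e * e * q s * (3 * f s v * q' s + 2 * pd cs f s v * q s)); [ring|].
      rewrite hT; ring.
  - rewrite (biharmonic_cylinder_iff s0 s1 v0 v1) by auto; intros h.
    (* A biharmonic cylinder has curvature identically zero, hence constant. *)
    apply hnc; exists 0; auto.
Qed.

Theorem theorem2p9 (s0 s1 v0 v1 : Rbar) (a : R -> R3) (b : R3) (f : R -> R -> R)
  (hI : Rbar_lt s0 s1) (hJ : Rbar_lt v0 v1)
  (a_smooth : smooth_curve (interval s0 s1) a)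
  (a_arclength : forall s, interval s0 s1 s -> dot (deriv3 a s) (deriv3 a s) = 1)
  (b_unit : dot b b = 1)
  (ab_orthogonal : forall s, interval s0 s1 s -> dot (deriv3 a s) b = 0)
  (f_smooth : smooth (rectangle (interval s0 s1) (interval v0 v1)) f)
  (f_pos : forall s v, interval s0 s1 s -> interval v0 v1 v -> 0 < f s v) :
  proper_f_biharmonic_surface (rectangle (interval s0 s1) (interval v0 v1)) f
    (cylinder a b) <->
  (circular_case (interval s0 s1) (interval v0 v1) a b f \/
   nonconstant_case (interval s0 s1) (interval v0 v1) a b f).
Proof.
  assert (ha : unit_speed_orthogonal s0 s1 a b)
    by exact (conj a_smooth (conj a_arclength (conj b_unit ab_orthogonal))).
  split.
  - apply proper_f_biharmonic_classification; auto.
  - intros [h|h].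
    + apply circular_case_proper; auto.
    + apply nonconstant_case_proper; auto.
Qed.
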